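(* Let $R$ be a commutative Noetherian ring, $\alpha$ an automorphism of $R$, and $S=R[\theta;\alpha]$. Suppose $S$ is primitive. (a) If $R$ has Krull dimension $0$, then $S$ satisfies $(\diamond)$. (b) Suppose $R$ contains an uncountable field, and that either $R$ has Krull dimension at least $2$ or $\mathrm{Spec}(R)$ is uncountable. Then $S$ does not satisfy $(\diamond)$.
   Context: $R[\theta;\alpha]$: skew polynomial ring with $\theta r=\alpha(r)\theta$. A ring is primitive if it has a faithful simple right module. A ring satisfies $(\diamond)$ if for every simple right module $V$, every finitely generated submodule of the injective hull $E(V)$ is Artinian. *)

(* Defs.v *)
From HB Require Import structures.
From mathcomp Require Import all_boot all_order all_algebra.
Set Implicit Arguments. Unset Strict Implicit. Unset Printing Implicit Defensive.
Import GRing.Theory.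
Local Open Scope ring_scope.

Definition is_ideal (R : comNzRingType) (I : R -> Prop) : Prop :=
  [/\ I 0, (forall x y, I x -> I y -> I (x + y)) & (forall r x, I x -> I (r * x))].

Definition is_prime_ideal (R : comNzRingType) (P : R -> Prop) : Prop :=
  [/\ is_ideal P, ~ P 1 & (forall a b, P (a * b) -> P a \/ P b)].

Definition noetherian_ring (R : comNzRingType) : Prop :=
  forall I : nat -> R -> Prop, (forall n, is_ideal (I n)) ->
    (forall n x, I n x -> I n.+1 x) ->
    exists n, forall m, (n <= m)%N -> forall x, I m x <-> I n x.

Definition krull_dim_ge (R : comNzRingType) (n : nat) : Prop :=
  exists P : nat -> R -> Prop,
    (forall i, (i <= n)%N -> is_prime_ideal (P i)) /\
    (forall i, (i < n)%N ->
       (forall x, P i x -> P i.+1 x) /\ exists x, P i.+1 x /\ ~ P i x).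

Definition krull_dim_eq (R : comNzRingType) (n : nat) : Prop :=
  krull_dim_ge R n /\ ~ krull_dim_ge R n.+1.

Definition spec_uncountable (R : comNzRingType) : Prop :=
  ~ exists f : nat -> R -> Prop,
      forall P, is_prime_ideal P -> exists n, forall x, f n x <-> P x.

Definition uncountable_type (T : Type) : Prop :=
  ~ exists f : nat -> T, forall x, exists n, f n = x.

(* R contains an uncountable field (ring morphisms out of a field are injective) *)
Definition contains_uncountable_field (R : comNzRingType) : Prop :=
  exists (F : fieldType) (phi : {rmorphism F -> R}), uncountable_type F.

(* S = R[th; alpha]: S contains R via iota, th * r = alpha(r) * th, and S is
   the free left R-module on 1, th, th^2, ... *)
Definition is_skew_poly_ring (R : comNzRingType) (alpha : R -> R)
    (S : nzRingType) (iota : {rmorphism R -> S}) (th : S) : Prop :=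
  (forall r, th * iota r = iota (alpha r) * th) /\
  bijective (fun p : {poly R} => \sum_(i < size p) iota p`_i * th ^+ i).

(* ---------- Right modules: right S-modules are left S^c-modules ---------- *)

Definition is_submod (S : nzRingType) (M : lmodType S^c) (N : M -> Prop) : Prop :=
  [/\ N 0, (forall x y, N x -> N y -> N (x + y)) &
      (forall (s : S^c) x, N x -> N (s *: x))].

Definition simple_mod (S : nzRingType) (M : lmodType S^c) : Prop :=
  (exists x : M, x <> 0) /\
  forall N : M -> Prop, is_submod N -> (forall x, N x -> x = 0) \/ (forall x, N x).

Definition faithful_mod (S : nzRingType) (M : lmodType S^c) : Prop :=
  forall s : S^c, (forall m : M, s *: m = 0) -> s = 0.

Definition primitive_ring (S : nzRingType) : Prop :=
  exists M : lmodType S^c, simple_mod M /\ faithful_mod M.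

Definition injective_mod (S : nzRingType) (E : lmodType S^c) : Prop :=
  forall (A B : lmodType S^c) (i : {linear A -> B}) (f : {linear A -> E}),
    injective i -> exists g : {linear B -> E}, forall a, g (i a) = f a.

Definition essential_ext (S : nzRingType) (V E : lmodType S^c)
    (j : {linear V -> E}) : Prop :=
  forall N : E -> Prop, is_submod N -> (exists x, N x /\ x <> 0) ->
    exists v, N (j v) /\ j v <> 0.

Definition injective_hull (S : nzRingType) (V E : lmodType S^c)
    (j : {linear V -> E}) : Prop :=
  [/\ injective j, injective_mod E & essential_ext j].

Definition fg_submod (S : nzRingType) (M : lmodType S^c) (N : M -> Prop) : Prop :=
  exists n (g : 'I_n -> M),
    forall x, N x <-> exists c : 'I_n -> S^c, x = \sum_(i < n) c i *: g i.

Definition artinian_submod (S : nzRingType) (M : lmodType S^c) (N : M -> Prop) : Prop :=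
  forall D : nat -> M -> Prop, (forall n, is_submod (D n)) ->
    (forall x, D 0%N x -> N x) -> (forall n x, D n.+1 x -> D n x) ->
    exists n, forall m, (n <= m)%N -> forall x, D m x <-> D n x.

Definition diamond (S : nzRingType) : Prop :=
  forall (V E : lmodType S^c) (j : {linear V -> E}),
    simple_mod V -> injective_hull j ->
    forall N : E -> Prop, fg_submod N -> artinian_submod N.

(* Main.v *)
Require Import Defs.
From HB Require Import structures.
From mathcomp Require Import all_boot all_order all_algebra.
From mathcomp Require Import boolp classical_sets.
From mathcomp Require Import ring.
Set Implicit Arguments. Unset Strict Implicit. Unset Printing Implicit Defensive.
Import GRing.Theory.
Local Open Scope ring_scope.

(**
(a) Primitivity forces R to be reduced, so in dimension 0 it is von Neumann
regular, hence Artinian. Let V be simple and essential in E, and let x be in E.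
The ideals {r | x r th^k is in the sum of the x R th^j, j < k} increase with k;
let fR, f idempotent, be their limit. If f <> 1, then with g = 1 - f the nonzero
submodules x g th^l S all contain V for large l, while their intersection is 0.
So f = 1, xS is finitely generated over R, and hence Artinian.

(b) Let M be a faithful simple module and m in M with prime annihilator P in R.
Since m lies in m th S, P is periodic under alpha, and its orbit intersects in 0.
There are countably many elements s_i outside P such that m is not in (MQ)_Q for
every prime Q > P avoiding all s_i. Such a Q exists by Krull's principal ideal
theorem and countable prime avoidance (this uses the uncountable field), or
because Spec R is uncountable. The orbit of Q is infinite, so countable avoidance
gives a regular b in Q outside all the other translates of Q. In the injective
hull of M choose e with e b = m: then the chain e th^l S is strictly decreasing,
as equality would put m c in MQ for a product c of translates of b outside Q.
The hull exists because M embeds in the injective module Hom_F(S, M), for F a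
field in R.
*)

(** * Ideals of Noetherian rings *)

Section Ideals.
Variable R : comNzRingType.
Implicit Types (A I J P Q : R -> Prop).

Definition sub_pred (T : Type) (A B : T -> Prop) := forall x, A x -> B x.

Lemma ideal_opp I x : is_ideal I -> I x -> I (- x).
Proof. by move=> [_ _ hM] Ix; rewrite -mulN1r; apply: (hM). Qed.

Lemma ideal_subr I x y : is_ideal I -> I x -> I y -> I (x - y).
Proof. by move=> hI Ix Iy; case: (hI) => _ hD _; apply: hD => //; exact: ideal_opp. Qed.

Lemma ideal_mulr I x r : is_ideal I -> I x -> I (x * r).
Proof. by move=> [_ _ hM] Ix; rewrite mulrC; apply: (hM). Qed.

Lemma prime_is_ideal P : is_prime_ideal P -> is_ideal P.
Proof. by case. Qed.

Lemma primeN P a b : is_prime_ideal P -> ~ P a -> ~ P b -> ~ P (a * b).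
Proof. by move=> [_ _ h] na nb /h []. Qed.

Lemma prime_exp P a n : is_prime_ideal P -> P (a ^+ n) -> P a.
Proof.
move=> hP; elim: n => [|n IH]; first by case: hP => _ h1 _ /h1.
by rewrite exprS; case: (hP) => _ _ h /h [].
Qed.

Lemma prime_prodN P n (F : nat -> R) : is_prime_ideal P ->
  (forall i, (i < n)%N -> ~ P (F i)) -> ~ P (\prod_(i < n) F i).
Proof.
move=> hP; elim: n => [|n IH] hF; first by rewrite big_ord0; case: hP.
rewrite big_ord_recr /=; apply: primeN => //; last exact: hF.
by apply: IH => i ltin; apply: hF; exact: ltnW.
Qed.

Definition adjoin A (g : R) : R -> Prop := fun x => exists a r, A a /\ x = a + r * g.

Lemma adjoin_ideal A g : is_ideal A -> is_ideal (adjoin A g).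
Proof.
move=> [h0 hD hM]; split.
- by exists 0, 0; rewrite mul0r addr0.
- move=> x y [a [r [Aa ->]]] [b [s [Ab ->]]]; exists (a + b), (r + s).
  by split; [exact: hD | rewrite mulrDl addrACA].
- move=> r x [a [s [Aa ->]]]; exists (r * a), (r * s).
  by split; [exact: hM | rewrite mulrDr mulrA].
Qed.

Lemma adjoin_sub A g : sub_pred A (adjoin A g).
Proof. by move=> x Ax; exists x, 0; rewrite mul0r addr0. Qed.

Lemma adjoin_gen A g : is_ideal A -> adjoin A g g.
Proof. by move=> [h0 _ _]; exists 0, 1; rewrite mul1r add0r. Qed.

Lemma adjoin_min A g I : is_ideal I -> sub_pred A I -> I g -> sub_pred (adjoin A g) I.
Proof.
move=> [_ hD hM] AI Ig x [a [r [Aa ->]]]; apply: (hD); [exact: AI | exact: hM].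
Qed.

Lemma zero_ideal : is_ideal (fun x : R => x = 0).
Proof.
split=> // [x y -> ->|r x ->]; [exact: addr0 | exact: mulr0].
Qed.

Lemma colon_ideal A g : is_ideal A -> is_ideal (fun r => A (r * g)).
Proof.
move=> [h0 hD hM]; split=> [|x y|r x]; rewrite ?mul0r ?mulrDl -?mulrA //; auto.
Qed.

(** Without a maximal member, choice gives every member a strictly larger one, and iteration
    contradicts the ascending chain condition. *)
Lemma noetherian_max (F : (R -> Prop) -> Prop) : noetherian_ring R ->
  (exists I, F I) -> (forall I, F I -> is_ideal I) ->
  exists I, F I /\ forall J, F J -> sub_pred I J -> sub_pred J I.
Proof.
move=> hR [I0 FI0] hF; apply: contrapT => nmax.
have step (I : {I | F I}) : exists J : {J | F J},
    sub_pred (sval I) (sval J) /\ ~ sub_pred (sval J) (sval I).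
  case: I => I FI; apply: contrapT => nJ; apply: nmax; exists I; split=> // J FJ IJ.
  apply: contrapT => nJI; apply: nJ; by exists (exist _ J FJ).
have [next hnext] := choice step.
pose C n := iter n next (exist _ I0 FI0).
have [|n x|n hn] := hR (fun n => sval (C n)).
- by move=> n; apply: hF; case: (C n).
- by case: (hnext (C n)) => h _; exact: h.
case: (hnext (C n)) => _; apply => x.
by case: (hn n.+1 (leqnSn n) x).
Qed.

(** An ideal maximal among those containing [I] and missing [U] is prime: if [a] and [b] lie outside
    [Q], both [Q + (a)] and [Q + (b)] meet [U], hence so does [Q + (a b)]. *)
Lemma prime_avoiding (U I : R -> Prop) : noetherian_ring R ->
  U 1 -> (forall x y, U x -> U y -> U (x * y)) ->
  is_ideal I -> (forall x, I x -> ~ U x) ->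
  exists Q, [/\ is_prime_ideal Q, sub_pred I Q & forall x, Q x -> ~ U x].
Proof.
move=> hR U1 UM hI IU.
pose F J := [/\ is_ideal J, sub_pred I J & forall x, J x -> ~ U x].
have [|J []//|Q [[hQ IQ QU] Qmax]] := @noetherian_max F hR.
  by exists I; split.
exists Q; split=> //; split=> // [/QU//|a b Qab].
have meet c : ~ Q c -> exists x, adjoin Q c x /\ U x.
  move=> nQc; apply: contrapT => nm; apply: nQc.
  apply: (Qmax (adjoin Q c)); last exact: adjoin_gen.
    split; [exact: adjoin_ideal| |].
      by move=> x Ix; apply: adjoin_sub; exact: IQ.
    by move=> x ax Ux; apply: nm; exists x.
  exact: adjoin_sub.
case: (EM (Q a)) => [|/meet [x [[q [r [Qq ->]]] Ux]]]; first by left.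
case: (EM (Q b)) => [|/meet [y [[q' [r' [Qq' ->]]] Uy]]]; first by right.
case: (QU _ _ (UM _ _ Ux Uy)).
have [_ hD hM] := hQ.
rewrite mulrDl; apply: (hD); first exact: ideal_mulr.
rewrite mulrDr; apply: (hD); first exact: (hM).
have -> : r * a * (r' * b) = r * r' * (a * b) by ring.
exact: (hM).
Qed.

(* [prime_filtration A s]: a chain A = A_0 < A_1 < ... < A_n = R of ideals whose
   cyclic factors A_(i+1)/A_i are isomorphic to R/p_i, the p_i being the primes
   listed in [s]. *)
Inductive prime_filtration : (R -> Prop) -> seq (R -> Prop) -> Prop :=
| prime_filtration_top A : A 1 -> prime_filtration A [::]
| prime_filtration_step A g s : is_prime_ideal (fun r => A (r * g)) ->
    prime_filtration (adjoin A g) s ->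
    prime_filtration A ((fun r => A (r * g)) :: s).

(** A maximal counterexample [B] is proper. A maximal colon ideal [(B : g)] with [g] outside [B] is
    prime, and [B + (g)] has a filtration, which then extends to [B]. *)
Lemma prime_filtration_exists A : noetherian_ring R -> is_ideal A ->
  exists s, prime_filtration A s.
Proof.
move=> hR hA; apply: contrapT => nA.
pose F J := is_ideal J /\ ~ exists s, prime_filtration J s.
have [|J []//|B [[hB nB] Bmax]] := @noetherian_max F hR.
  by exists A.
pose G J := exists g, ~ B g /\ J = (fun r => B (r * g)).
have nB1 : ~ B 1.
  by move=> B1; apply: nB; exists [::]; exact: prime_filtration_top.
have [|J [g [_ ->]]|L [[g [nBg eL]] Lmax]] := @noetherian_max G hR.
- by exists (fun r => B (r * 1)), 1.
- exact: colon_ideal.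
have hL : is_prime_ideal (fun r => B (r * g)).
  split; [exact: colon_ideal | by rewrite mul1r|].
  move=> a b Bab; case: (EM (B (b * g))) => [|nBb]; [by right | left].
  have /Lmax h : G (fun r => B (r * (b * g))) by exists (b * g).
  have : L a by apply: h; rewrite ?eL ?mulrA // => x; rewrite mulrCA => Bx; case: hB => _ _; apply.
  by rewrite eL.
have [s hs] : exists s, prime_filtration (adjoin B g) s.
  apply: contrapT => ns; apply: nBg; apply: (Bmax (adjoin B g)).
  - by split=> //; exact: adjoin_ideal.
  - exact: adjoin_sub.
  - exact: adjoin_gen.
by apply: nB; eexists; apply: prime_filtration_step hs.
Qed.

Lemma prime_filtration_prime A s : is_ideal A -> prime_filtration A s ->
  forall L, List.In L s -> is_prime_ideal L /\ sub_pred A L.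
Proof.
move=> hA hs; elim: hs hA => {A s} [//|A g s hL _ IH hA L /= [<-|]].
  by split=> // x Ax; exact: ideal_mulr.
move/(IH (adjoin_ideal g hA)) => [hL' AL]; split=> // x Ax; apply: AL; exact: adjoin_sub.
Qed.

(** At each step either [g] is in [Q], and [A + (g)] stays inside [Q], or [(A : g)] is inside [Q].
    Hence all minimal primes over [A] occur in the finite list [s]. *)
Lemma prime_filtration_sub A s Q : prime_filtration A s -> is_prime_ideal Q ->
  sub_pred A Q -> exists L, List.In L s /\ sub_pred L Q.
Proof.
move=> hs hQ; elim: hs => {A s} [A A1 AQ|A g s hL _ IH AQ].
  by case: hQ => _ nQ1 _; case: nQ1; exact: AQ.
case: (EM (Q g)) => [Qg|nQg].
  have [|L [sL LQ]] := IH; first by apply: adjoin_min => //; exact: prime_is_ideal.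
  by exists L; split=> //; right.
exists (fun r => A (r * g)); split; [by left | move=> r /AQ].
by case: (hQ) => _ _ h /h [].
Qed.

(** The contraction to [R] of the localisation of [A] at [Q]; it stands in for the local ring. *)
Definition saturation Q A : R -> Prop := fun r => exists t, ~ Q t /\ A (t * r).

Lemma saturation_ideal Q A : is_prime_ideal Q -> is_ideal A ->
  is_ideal (saturation Q A).
Proof.
move=> hQ [a0 aD aM]; split.
- by exists 1; rewrite mulr0; split=> //; case: hQ.
- move=> x y [t [nt hx]] [u [nu hy]]; exists (t * u); split; first exact: primeN.
  rewrite mulrDr; apply: (aD); last by rewrite -mulrA; apply: (aM).
  by rewrite mulrAC mulrC; apply: (aM).
- move=> r x [t [nt hx]]; exists t; split=> //; rewrite mulrCA; exact: aM.
Qed.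

Lemma saturation_sub Q A : is_prime_ideal Q -> sub_pred A (saturation Q A).
Proof. by move=> [_ nQ1 _] x Ax; exists 1; rewrite mul1r. Qed.

Lemma saturationM Q A t x : is_prime_ideal Q -> ~ Q t ->
  saturation Q A (t * x) -> saturation Q A x.
Proof.
by move=> hQ nt [u [nu h]]; exists (u * t); split; [exact: primeN | rewrite -mulrA].
Qed.

(** * Minimal primes and the principal ideal theorem *)

Definition minimal_over A Q :=
  [/\ is_prime_ideal Q, sub_pred A Q &
      forall L, is_prime_ideal L -> sub_pred A L -> sub_pred L Q -> sub_pred Q L].

Lemma min_in_seq (s : seq (R -> Prop)) Q0 :
  (exists L, List.In L s /\ sub_pred L Q0) ->
  exists L, [/\ List.In L s, sub_pred L Q0 &
    forall L', List.In L' s -> sub_pred L' L -> sub_pred L L'].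
Proof.
elim: s => [[L []//]|B s IH [L [/= sL LQ]]].
case: (EM (exists L, List.In L s /\ sub_pred L Q0)) => [/IH [K [sK KQ Kmin]]|nex].
  case: (EM (sub_pred B K)) => [BK|nBK]; last first.
    by exists K; split=> //=; [right | move=> L' [<- //|]; exact: Kmin].
  exists B; split=> //=; [by left | by move=> x /BK /KQ |].
  move=> L' [<- //|sL' L'B x /BK].
  by apply: Kmin => // y /L'B /BK.
case: sL => [eL|sL]; last by case: nex; exists L.
subst L; exists B; split=> //=; first by left.
move=> L' [<- //|sL' L'B]; case: nex; exists L'; split=> // x /L'B; exact: LQ.
Qed.

Lemma minimal_over_exists A Q0 : noetherian_ring R -> is_ideal A ->
  is_prime_ideal Q0 -> sub_pred A Q0 ->
  exists Q, minimal_over A Q /\ sub_pred Q Q0.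
Proof.
move=> hR hA hQ0 AQ0; have [s hs] := prime_filtration_exists hR hA.
have [Q [sQ QQ0 Qmin]] := min_in_seq (prime_filtration_sub hs hQ0 AQ0).
have [hQ AQ] := prime_filtration_prime hA hs sQ.
exists Q; split=> //; split=> // L hL AL LQ.
have [K [sK KL]] := prime_filtration_sub hs hL AL.
move=> x Qx; apply: (KL); apply: Qmin Qx => // y /KL; exact: LQ.
Qed.

(* The localisation at a minimal prime [Q] of [A] kills all factors of a prime
   filtration except those isomorphic to [R/Q], which become simple. *)
Lemma saturation_dcc A s Q : is_ideal A -> prime_filtration A s ->
  is_prime_ideal Q ->
  (forall L, is_prime_ideal L -> sub_pred A L -> sub_pred L Q -> sub_pred Q L) ->
  forall D : nat -> R -> Prop, (forall n, is_ideal (D n)) ->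
  (forall n, sub_pred A (D n)) -> (forall n, sub_pred (D n.+1) (D n)) ->
  exists n, forall k, (n <= k)%N -> sub_pred (D k) (saturation Q (D k.+1)).
Proof.
move=> hA hs hQ; elim: hs hA => {A s} [A A1 _ _ D hD AD _|A g s hL hs IH hA Qmin D hD AD Ddec].
  exists 0%N => k _ x _; exists 1; rewrite mul1r; split; first by case: hQ.
  rewrite -[x]mulr1; case: (hD k.+1) => _ _; apply; exact: AD.
have [|||||n hn] := IH _ _ (fun k => adjoin (D k) g).
- exact: adjoin_ideal.
- move=> L hL' AL; apply: Qmin => // x Ax; apply: AL; exact: adjoin_sub.
- by move=> k; exact: adjoin_ideal.
- move=> k; apply: adjoin_min; [exact: adjoin_ideal | | exact: adjoin_gen].
  by move=> x Ax; apply: adjoin_sub; exact: AD.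
- move=> k; apply: adjoin_min; [exact: adjoin_ideal | | exact: adjoin_gen].
  by move=> x Ax; apply: adjoin_sub; exact: Ddec.
(* [B k] says that [D k] contains a generator of the factor [(A + (g))/A] localised at [Q]. *)
pose B k := exists u, ~ Q u /\ D k (u * g).
have key k : (n <= k)%N -> B k.+1 \/ (forall u, D k (u * g) -> D k.+1 (u * g)) ->
    sub_pred (D k) (saturation Q (D k.+1)).
  move=> nk hB x Dx.
  have [t [nQt [d [u [Dd e]]]]] := hn k nk x (adjoin_sub g Dx).
  have Du : D k (u * g).
    have -> : u * g = t * x - d by rewrite e; ring.
    apply: ideal_subr => //; last exact: Ddec.
    by case: (hD k) => _ _; apply.
  case: hB => [[v [nQv Dv]]|/(_ _ Du) Du'].
    exists (v * t); split; first exact: primeN.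
    have -> : v * t * x = v * d + u * (v * g) by rewrite -mulrA e; ring.
    by case: (hD k.+1) => _ hadd hmul; apply: (hadd); apply: (hmul).
  by exists t; split=> //; rewrite e; case: (hD k.+1) => _ hadd _; apply: hadd.
(* If [B] fails at [k0], it fails from there on. Then [(A : g)] lies in [Q], so equals [Q] by
   minimality, and every [u * g] in [D k] is already in [A]. *)
case: (EM (forall k, B k)) => [allB|/existsNP [k0 nB]].
  by exists n => k nk; apply: key => //; left.
exists (maxn n k0) => k; rewrite geq_max => /andP [nk k0k]; apply: key => //; right.
have nBk : ~ B k.
  move: k0k => /subnKC <-; elim: (k - k0)%N => [|j IHj]; first by rewrite addn0.
  by rewrite addnS => -[u [nQu Du]]; apply: IHj; exists u; split=> //; exact: Ddec.
have sQ : sub_pred (fun r => A (r * g)) Q.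
  move=> r Ar; apply: contrapT => nQr; apply: nBk; exists r; split=> //; exact: AD.
move=> u Du; have Qu : Q u by apply: contrapT => nQu; apply: nBk; exists u.
apply: AD; apply: (Qmin (fun r => A (r * g))) => // x Ax; exact: ideal_mulr.
Qed.

(* Krull's principal ideal theorem for the domain R/P. *)
Lemma principal_ideal_theorem P c Q P' : noetherian_ring R ->
  is_prime_ideal P -> minimal_over (adjoin P c) Q ->
  is_prime_ideal P' -> sub_pred P P' -> sub_pred P' Q -> ~ sub_pred Q P' ->
  sub_pred P' P.
Proof.
move=> hR hP [hQ AQ Qmin] hP' PP' P'Q nQP' p P'p; apply: contrapT => nPp.
have iP := prime_is_ideal hP; have iP' := prime_is_ideal hP'; have iQ := prime_is_ideal hQ.
have hA := adjoin_ideal c iP.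
have nP'c : ~ P' c.
  move=> P'c; apply: nQP'; apply: Qmin => //; exact: adjoin_min.
have Qc : Q c by apply: AQ; exact: adjoin_gen.
(* The contractions of the powers of [p] from the localisation of [R/P] at [P'], in place of the
   symbolic powers of [P']. *)
pose I n := saturation P' (adjoin P (p ^+ n)).
have iI n : is_ideal (I n) by apply: saturation_ideal => //; exact: adjoin_ideal.
have Idec n : sub_pred (I n.+1) (I n).
  move=> x [t [nt [a [r [Pa e]]]]]; exists t; split=> //.
  by exists a, (r * p); rewrite e exprS; split=> //; ring.
have [s hs] := prime_filtration_exists hR hA.
(* [R/(P + (c))] localised at [Q] has finite length, so the ideals [I n + (c)] are eventually
   constant at [Q]. *)
have [|||n hn] := saturation_dcc hA hs hQ Qmin (D := fun n => adjoin (I n) c).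
- by move=> n; exact: adjoin_ideal.
- move=> n; apply: adjoin_min; [exact: adjoin_ideal | | exact: adjoin_gen].
  move=> x Px; apply: adjoin_sub; apply: saturation_sub => //; exact: adjoin_sub.
- move=> n; apply: adjoin_min; [exact: adjoin_ideal | | exact: adjoin_gen].
  by move=> x Ix; apply: adjoin_sub; exact: Idec.
have {}hn x : I n x -> exists t d z, [/\ ~ Q t, I n.+1 d, I n z & t * x = d + c * z].
  move=> Ix; have [t [nt [d [z [Id e]]]]] := hn n (leqnn n) x (adjoin_sub c Ix).
  exists t, d, z; split; rewrite 1?[c * z]mulrC //.
  suff: I n (c * z) by exact: saturationM.
  have -> : c * z = t * x - d by rewrite e; ring.
  apply: (ideal_subr (iI n)); last exact: Idec.
  by have [_ _ hmul] := iI n; exact: (hmul t x Ix).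
have Ipn : I n (p ^+ n) by apply: saturation_sub => //; exact: adjoin_gen.
(* Nakayama's lemma for I_n = I_(n+1) + c I_n at Q, with a maximal Q-saturated
   proper subideal of I_n in place of generators. *)
have [t [nQt It]] : saturation Q (I n.+1) (p ^+ n).
  apply: contrapT => nsat.
  pose F W := [/\ is_ideal W, sub_pred (I n.+1) W,
    forall t x, ~ Q t -> W (t * x) -> W x & exists x, I n x /\ ~ W x].
  have [|W []//|W [[iW IW Wsat [h [Ih nWh]]] Wmax]] := @noetherian_max F hR.
    exists (saturation Q (I n.+1)); split.
    - exact: saturation_ideal.
    - exact: saturation_sub.
    - by move=> t x; exact: saturationM.
    - by exists (p ^+ n).
  have cW z : I n z -> W (c * z).
    move=> Iz; apply: contrapT => nWcz.
    pose W' := saturation Q (adjoin W (c * z)).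
    have iW' : is_ideal W' by apply: saturation_ideal => //; exact: adjoin_ideal.
    have W'1 x : adjoin W (c * z) x -> W' x by exact: saturation_sub.
    have full x : I n x -> W' x.
      move=> Ix; apply: contrapT => nx; apply: nWcz; apply: (Wmax W').
      - split=> //; last by exists x.
        + by move=> y Iy; apply: W'1; apply: adjoin_sub; exact: IW.
        + by move=> t y; exact: saturationM.
      - by move=> y Wy; apply: W'1; exact: adjoin_sub.
      - by apply: W'1; exact: adjoin_gen.
    have [t [nt [w [r [Ww e]]]]] := full z Iz.
    have Wz : W z.
      apply: (Wsat (t - r * c)).
        move=> Qt; apply: nt; rewrite -[t](subrK (r * c)); case: (iQ) => _ QD QM.
        by apply: (QD) => //; apply: QM.
      by rewrite mulrBl e -mulrA addrK.
    by apply: nWcz; case: iW => _ _; apply.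
  apply: nWh; have [t [d [z [nt Id Iz e]]]] := hn h Ih.
  apply: (Wsat t) => //; rewrite e; case: (iW) => _ WD _; apply: WD; first exact: IW.
  exact: cW.
have [u [nu [a [r [Pa e]]]]] := It.
(* Cancelling [p ^+ n] modulo the prime [P] leaves [u * t - r * p] in [P]. As [p] is in [P'], so is
   [u * t], although neither factor is. *)
have : P (p ^+ n * (u * t - r * p)).
  have -> : p ^+ n * (u * t - r * p) = a.
    by rewrite mulrBr -[X in X - _]mulrC -mulrA e exprS; ring.
  by [].
case: (hP) => _ _ h /h [/(prime_exp hP)//|Put].
have P'ut : P' (u * t).
  rewrite -[u * t](subrK (r * p)); case: (iP') => _ aD aM; apply: (aD); first exact: PP'.
  exact: aM.
have [_ _ h'] := hP'; case: (h' _ _ P'ut) => [//|/P'Q]; exact: nQt.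
Qed.

(** Take [A] inside [I] maximal for having an element [y] that lies only in those [J i] containing
    [A]. If [x] in [I] is not in [A], every [x + l y] with [l] in [F] lies in some [J i] not
    containing [A + (x)]. Each [i] serves at most one [l], so [F] would be countable. *)
Lemma countable_avoidance (F : fieldType) (phi : {rmorphism F -> R})
    I (J : nat -> R -> Prop) : noetherian_ring R -> uncountable_type F ->
  is_ideal I -> (forall i, is_ideal (J i)) ->
  exists c, I c /\ forall i, J i c -> sub_pred I (J i).
Proof.
move=> hR uF hI hJ.
pose G A := [/\ is_ideal A, sub_pred A I &
  exists y, A y /\ forall i, J i y -> sub_pred A (J i)].
have [|A []//|A [[hA AI [y [Ay hy]]] Amax]] := @noetherian_max G hR.
  exists (fun x => x = 0); split; [exact: zero_ideal | by move=> x ->; case: hI |].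
  by exists 0; split=> // i _ x ->; case: (hJ i).
suff IA : sub_pred I A.
  by exists y; split=> [|i Jy x /IA]; [exact: AI | exact: hy].
move=> x Ix; apply: contrapT => nAx; apply: uF.
have bad (l : F) : exists i, J i (x + phi l * y) /\ ~ sub_pred (adjoin A x) (J i).
  apply: contrapT => nb; apply: nAx; apply: (Amax (adjoin A x)).
  - split; [exact: adjoin_ideal | exact: adjoin_min |].
    exists (x + phi l * y); split.
      exists (phi l * y), 1; rewrite mul1r addrC; split=> //.
      by case: hA => _ _; apply.
    by move=> i Ji; apply: contrapT => n; apply: nb; exists i.
  - exact: adjoin_sub.
  - exact: adjoin_gen.
pose Bad i l := J i (x + phi l * y) /\ ~ sub_pred (adjoin A x) (J i).
have Bad_inj i l l' : Bad i l -> Bad i l' -> l = l'.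
  move=> [J1 n1] [J2 _]; apply/eqP; apply: contrapT => /negP nll; apply: n1.
  case: (hJ i) => _ JD JM.
  have Jy : J i y.
    have -> : y = phi (l - l')^-1 * ((x + phi l * y) - (x + phi l' * y)).
      have -> : (x + phi l * y) - (x + phi l' * y) = phi (l - l') * y.
        by rewrite rmorphB; ring.
      by rewrite mulrA -rmorphM mulVf ?subr_eq0 // rmorph1 mul1r.
    by apply: (JM); exact: ideal_subr.
  apply: adjoin_min => //; first exact: hy.
  have -> : x = (x + phi l * y) - phi l * y by ring.
  by apply: ideal_subr => //; apply: JM.
have ch i : exists l, (exists l', Bad i l') -> Bad i l.
  case: (EM (exists l', Bad i l')) => [[l' h]|n]; first by exists l'.
  by exists 0 => /n.
have [f hf] := choice ch; exists f => l.
have [i hi] := bad l; exists i; apply: (Bad_inj i) => //; apply: hf; by exists l.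
Qed.

(** The ideals [f^n(A)], written as preimages under [g^n], ascend and become constant; applying
    [g^n] there carries the equality back to [f(A) = A]. *)
Lemma automorphism_ideal_stable (f g : R -> R) A : noetherian_ring R ->
  cancel f g -> cancel g f -> (forall x y, g (x + y) = g x + g y) ->
  (forall x y, g (x * y) = g x * g y) ->
  is_ideal A -> (forall x, A (f x) -> A x) -> forall x, A x -> A (f x).
Proof.
move=> hR fK gK gD gM [h0 hD hM] hf x Ax.
have g0 : g 0 = 0 by apply: (addIr (g 0)); rewrite -gD !add0r.
have hg y : A y -> A (g y) by move=> Ay; apply: hf; rewrite gK.
have [n|n y|n hn] := hR (fun n y => A (iter n g y)).
- have iD y z : iter n g (y + z) = iter n g y + iter n g z.
    by elim: (n) => //= k ->.
  have iM y z : iter n g (y * z) = iter n g y * iter n g z.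
    by elim: (n) => //= k ->.
  have i0 : iter n g 0 = 0 by elim: (n) => //= k ->.
  by split=> [|y z|r y]; rewrite ?i0 ?iD ?iM //; auto.
- exact: hg.
have : A (iter n.+1 g (iter n.+1 f x)).
  by have -> : iter n.+1 g (iter n.+1 f x) = x by elim: n.+1 => //= k; rewrite -iterS iterSr fK.
move/(hn n.+1 (leqnSn n)); rewrite iterSr.
by have -> : iter n g (iter n f (f x)) = f x by elim: n {hn} => //= k; rewrite -iterS iterSr fK.
Qed.

(** * Primes above [P] avoiding countably many elements *)

Lemma In_nth (T : Type) (d x : T) (s : seq T) : List.In x s -> exists k, nth d s k = x.
Proof.
elim: s => //= y s IH [->|/IH [k <-]]; [by exists 0%N | by exists k.+1].
Qed.

Lemma nth_In (T : Type) (d : T) (s : seq T) k : nth d s k = d \/ List.In (nth d s k) s.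
Proof.
elim: s k => [|x s IH] [|k] /=; [by left | by left | by right; left |].
by case: (IH k); [left | right; right].
Qed.

(** Every prime over [P] containing some [s i] contains a [J n] with [s i] in it. Given a chain
    [P < P1 < P2], choose [c] in [P2] outside each [J n] not containing [P2], and [Q] minimal over
    [P + (c)] inside [P2]. Without a chain, a prime over [P] containing some [s i] equals a [J n],
    and uncountability gives another prime. *)
Lemma prime_above_avoiding (F : fieldType) (phi : {rmorphism F -> R}) P (s : nat -> R) :
  noetherian_ring R -> uncountable_type F -> is_prime_ideal P ->
  (forall i, ~ P (s i)) ->
  (exists P1 P2, [/\ is_prime_ideal P1, is_prime_ideal P2,
      sub_pred P P1 /\ ~ sub_pred P1 P & sub_pred P1 P2 /\ ~ sub_pred P2 P1]) \/
  (~ exists f : nat -> R -> Prop, forall Q, is_prime_ideal Q -> sub_pred P Q ->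
      exists n, forall x, f n x <-> Q x) ->
  exists Q, [/\ is_prime_ideal Q, sub_pred P Q, ~ sub_pred Q P & forall i, ~ Q (s i)].
Proof.
move=> hR uF hP nPs hyp; have iP := prime_is_ideal hP.
have iA i := adjoin_ideal (s i) iP.
have [l hl] := choice (fun i => prime_filtration_exists hR (iA i)).
(* [J] lists the primes of the filtrations of all [P + (s i)]; the default [P] makes [P] itself
   occur. *)
pose J n := if unpickle n is Some ik then nth P (l ik.1) ik.2 else P.
have Jl i L : List.In L (l i) -> exists n, J n = L.
  move=> /(In_nth P) [k ek]; exists (pickle (i, k)).
  by rewrite /J pickleK.
have JP : exists n, J n = P.
  by exists (pickle (0%N, size (l 0%N))); rewrite /J pickleK nth_default.
have hJ n : is_prime_ideal (J n).
  rewrite /J; case: (unpickle n) => // -[i k] /=.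
  case: (nth_In P (l i) k) => [-> //|].
  by move=> /(prime_filtration_prime (iA i) (hl i)) [].
have below i Q : is_prime_ideal Q -> sub_pred P Q -> Q (s i) ->
    exists n, [/\ sub_pred P (J n), J n (s i) & sub_pred (J n) Q].
  move=> hQ PQ Qs.
  have [|L [sL LQ]] := prime_filtration_sub (hl i) hQ.
    by apply: adjoin_min => //; exact: prime_is_ideal.
  have [_ AL] := prime_filtration_prime (iA i) (hl i) sL.
  have [n eL] := Jl i L sL; exists n; rewrite eL; split=> //.
    by move=> x Px; apply: AL; exact: adjoin_sub.
  by apply: AL; exact: adjoin_gen.
case: (EM (exists P1 P2, [/\ is_prime_ideal P1, is_prime_ideal P2,
      sub_pred P P1 /\ ~ sub_pred P1 P & sub_pred P1 P2 /\ ~ sub_pred P2 P1]))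
   => [[P1 [P2 [hP1 hP2 [PP1 nP1P] [P12 nP21]]]]|nchain].
  have [c [P2c hc]] := countable_avoidance phi hR uF (prime_is_ideal hP2)
    (fun n => prime_is_ideal (hJ n)).
  have nPc : ~ P c.
    have [n eP] := JP; move: (hc n); rewrite eP => h /h P2P.
    by apply: nP21 => x /P2P /PP1.
  have [|Q [Qmin QP2]] := minimal_over_exists hR (adjoin_ideal c iP) hP2.
    by apply: adjoin_min; [exact: prime_is_ideal | move=> x /PP1 /P12 |].
  have pit := principal_ideal_theorem hR hP Qmin.
  have [hQ AQ _] := Qmin.
  have PQ : sub_pred P Q by move=> x Px; apply: AQ; exact: adjoin_sub.
  have Qc : Q c by apply: AQ; exact: adjoin_gen.
  exists Q; split=> // [QP|i Qs]; first by apply: nPc; exact: QP.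
  have [n [PJ Js JQ]] := below i Q hQ PQ Qs.
  (* Otherwise [J n] lies strictly below [Q], and the principal ideal theorem puts it inside [P],
     which avoids [s i]. *)
  have QJ : sub_pred Q (J n).
    by apply: contrapT => nQJ; apply: (nPs i); apply: (pit (J n)).
  have P2Q : sub_pred P2 Q by move=> x P2x; apply: JQ; apply: (hc n) => //; exact: QJ.
  (* Now [Q] contains [P2], so [P1] lies strictly between [P] and [Q], against the same theorem. *)
  apply: nP1P; apply: pit => // [x /P12 /P2Q//|QP1].
  by apply: nP21 => x /P2Q /QP1.
case: hyp => [//|nP]; apply: contrapT => nQ; apply: nP; exists J => Q hQ PQ.
case: (EM (sub_pred Q P)) => [QP|nQP].
  by have [n eP] := JP; exists n => x; rewrite eP; split; [exact: PQ | exact: QP].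
have [i Qs] : exists i, Q (s i).
  apply: contrapT => ns; apply: nQ; exists Q; split=> // i Qs; apply: ns; by exists i.
have [n [PJ Js JQ]] := below i Q hQ PQ Qs.
exists n => x; split; first exact: JQ.
move: x; apply: contrapT => nQJ; apply: nchain; exists (J n), Q; split=> //.
by split=> // h; apply: (nPs i); exact: h.
Qed.

(** * Reduced rings of dimension zero, and nilpotents *)

Lemma nilpotent_reduced (x : R) n : (forall y : R, y * y = 0 -> y = 0) ->
  x ^+ n = 0 -> x = 0.
Proof.
move=> red; elim: n => [|[|n] IH] => [/eqP|//|xn]; first by rewrite oner_eq0.
apply: IH; apply: red; rewrite -exprD.
by rewrite (_ : (n.+1 + n.+1 = n.+2 + n)%N) ?exprD ?xn ?mul0r // addnS.
Qed.

(** The elements [r^n (1 - r s)] form a multiplicative set. If it contains [0], then [r (1 - r s)]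
    is nilpotent, hence [0]. Otherwise a prime [Q] avoids it; then [Q + (r)] is proper, and a prime
    over it is strictly larger than [Q]. *)
Lemma dim0_von_neumann_regular : noetherian_ring R -> ~ krull_dim_ge R 1 ->
  (forall y : R, y * y = 0 -> y = 0) -> forall r : R, exists s, r = r * r * s.
Proof.
move=> hR ndim red r.
pose U x := exists n s, x = r ^+ n * (1 - r * s).
have U1 : U 1 by exists 0%N, 0; rewrite mulr0 subr0 mulr1.
have UM x y : U x -> U y -> U (x * y).
  move=> [n [s ->]] [m [t ->]]; exists (n + m)%N, (s + t - r * s * t).
  by rewrite exprD; ring.
case: (EM (U 0)) => [[n [s e]]|nU0].
  have /eqP : r * (1 - r * s) = 0.
    apply: (@nilpotent_reduced _ n.+1) => //.
    have -> : (r * (1 - r * s)) ^+ n.+1 = r ^+ n * (1 - r * s) * (r * (1 - r * s) ^+ n).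
      by rewrite exprMn !exprS; ring.
    by rewrite -e mul0r.
  by rewrite mulrBr mulr1 subr_eq0 mulrA => /eqP; exists s.
have [|Q [hQ _ QU]] := prime_avoiding hR U1 UM zero_ideal.
  by move=> x ->.
have [x y -> ->||x ax ex|Q2 [hQ2 sub _]] :=
    @prime_avoiding (fun x => x = 1) (adjoin Q r) hR erefl.
- exact: mulr1.
- by apply: adjoin_ideal; exact: prime_is_ideal.
- move: ax; rewrite ex => -[q [s [Qq e]]]; apply: (QU q Qq); exists 0%N, s.
  by rewrite mul1r e; ring.
case: ndim; exists (fun i => if i == 0%N then Q else Q2); split.
  by move=> [|i].
move=> [|//] _ /=; split=> [x Qx|]; first by apply: sub; exact: adjoin_sub.
exists r; split; first by apply: sub; apply: adjoin_gen; exact: prime_is_ideal.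
by move=> /QU; apply; exists 1%N, 0; rewrite mulr0 subr0 mulr1.
Qed.

(** Among the ideals [R e] with [e] an idempotent of [J], a maximal one is [J]: an [x] outside it
    yields an idempotent [e'] of [J] orthogonal to [e], and [R (e + e')] is larger. *)
Lemma regular_ideal_idempotent J : noetherian_ring R ->
  (forall r : R, exists s, r = r * r * s) -> is_ideal J ->
  exists f, [/\ J f, f * f = f & forall x, J x -> x = x * f].
Proof.
move=> hR reg hJ; have [J0 JD JM] := hJ.
pose G I := exists e, [/\ e * e = e, J e & I = fun x => exists r, x = r * e].
have [|I [e [_ _ ->]]|I [[e [ee Je eI]] Imax]] := @noetherian_max G hR.
- by exists (fun x => exists r, x = r * 0), 0; rewrite mulr0.
- split; first by exists 0; rewrite mul0r.
    by move=> x y [r ->] [s ->]; exists (r + s); rewrite mulrDl.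
  by move=> r x [s ->]; exists (r * s); rewrite mulrA.
exists e; split=> // x Jx.
have [s es] := reg (x * (1 - e)).
set y := x * (1 - e) in es; set e' := y * s.
have ye : y * e = 0 by rewrite /y -mulrA mulrBl mul1r ee subrr mulr0.
have yy : y * e' = y by rewrite /e' mulrA -es.
have e'e' : e' * e' = e' by rewrite {1 3}/e' mulrAC yy.
have ee' : e' * e = 0 by rewrite /e' mulrAC ye mul0r.
have Jy : J y by exact: ideal_mulr.
have Je' : J e' by exact: ideal_mulr.
have Iy : I y.
  apply: (Imax (fun x => exists r, x = r * (e + e'))).
  - exists (e + e'); split=> //; last exact: JD.
    by rewrite mulrDl !mulrDr ee [e * e']mulrC ee' e'e' addr0 add0r.
  - rewrite eI => z [r ->]; exists (r * e).
    by rewrite mulrDr -!mulrA ee [e * e']mulrC ee' mulr0 addr0.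
  - by exists y; rewrite mulrDr ye add0r yy.
move: Iy; rewrite eI => -[r er].
have y0 : y = 0 by rewrite -ye er -mulrA ee -er.
by move/eqP: y0; rewrite /y mulrBr mulr1 subr_eq0 => /eqP.
Qed.

(** The annihilators ascend and become constant; since [D m] is generated by an idempotent [f], it
    is recovered from its annihilator, which contains [1 - f]. *)
Lemma regular_dcc : noetherian_ring R -> (forall r : R, exists s, r = r * r * s) ->
  forall D : nat -> R -> Prop, (forall n, is_ideal (D n)) ->
  (forall n, sub_pred (D n.+1) (D n)) ->
  exists n, forall m, (n <= m)%N -> sub_pred (D n) (D m).
Proof.
move=> hR reg D hD Ddec.
have [n|n r h x Dx|n hn] := hR (fun n r => forall x, D n x -> r * x = 0).
- split=> [x _|r s hr hs x Dx|r s hs x Dx]; first exact: mul0r.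
    by rewrite mulrDl hr // hs // addr0.
  by rewrite -mulrA hs // mulr0.
- by apply: h; exact: Ddec.
exists n => m nm x Dx.
have [f [Df ff hf]] := regular_ideal_idempotent hR reg (hD m).
have /(hn m nm) h : forall y, D m y -> (1 - f) * y = 0.
  by move=> y /hf ey; rewrite mulrBl mul1r [f * y]mulrC -ey subrr.
have /eqP := h x Dx; rewrite mulrBl mul1r subr_eq0 => /eqP ->.
by apply: ideal_mulr.
Qed.

(** Take [r] with maximal annihilator among nonzero nilpotents. If a nilpotent [t] had [t r <> 0],
    maximality would give [t^i r <> 0] for every [i]. *)
Lemma nilpotent_annihilator : noetherian_ring R -> (exists x : R, x <> 0 /\ x * x = 0) ->
  exists r : R, [/\ r <> 0, exists k, r ^+ k = 0 &
    forall t, (exists k, t ^+ k = 0) -> t * r = 0].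
Proof.
move=> hR [x [x0 xx]].
pose G I := exists r, [/\ r <> 0, exists k, r ^+ k = 0 & I = fun t : R => t * r = 0].
have [|I [r [_ _ ->]]|I [[r [r0 [k rk] eI]] Imax]] := @noetherian_max G hR.
- by exists (fun t => t * x = 0), x; split=> //; exists 2.
- exact: (colon_ideal r zero_ideal).
exists r; split=> //; first by exists k.
move=> t [j tj]; apply: contrapT => tr.
have step i : t ^+ i * r <> 0.
  elim: i => [|i IH]; first by rewrite mul1r.
  rewrite exprS -mulrA => e; apply: tr; have : I t; last by rewrite eI.
  apply: (Imax (fun s => s * (t ^+ i * r) = 0)) => //.
    exists (t ^+ i * r); split=> //; exists k.
    by rewrite exprMn rk mulr0.
  by rewrite eI => s e'; rewrite mulrCA e' mulr0.
by apply: (step j); rewrite tj mul0r.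
Qed.

End Ideals.

(** * Modules over skew polynomial rings *)

Section RightAction.
Variables (R : comNzRingType) (S : nzRingType) (iota : {rmorphism R -> S}) (th : S).
Variable M : lmodType S^c.
Implicit Types (x y : M) (r : R) (N : M -> Prop).

(* In right module notation, [ract r x] is x r and [thact x] is x th. *)
Definition ract r x : M := (iota r : S^c) *: x.
Definition thact x : M := (th : S^c) *: x.

Lemma ractDl r s x : ract (r + s) x = ract r x + ract s x.
Proof. by rewrite /ract rmorphD scalerDl. Qed.
Lemma ractDr r x y : ract r (x + y) = ract r x + ract r y.
Proof. exact: scalerDr. Qed.
Lemma ractA r s x : ract r (ract s x) = ract (r * s) x.
Proof. by rewrite /ract scalerA mulrC rmorphM. Qed.
Lemma ract1 x : ract 1 x = x.
Proof. by rewrite /ract rmorph1; exact: scale1r. Qed.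
Lemma ract0l x : ract 0 x = 0.
Proof. by rewrite /ract rmorph0; exact: scale0r. Qed.
Lemma ract0r r : ract r 0 = 0.
Proof. exact: scaler0. Qed.
Lemma ractN1 x : ract (- 1) x = - x.
Proof. by rewrite /ract rmorphN1; exact: scaleN1r. Qed.
Lemma ractNl r x : ract (- r) x = - ract r x.
Proof. by rewrite -mulN1r -ractA ractN1. Qed.
Lemma ractBl r s x : ract (r - s) x = ract r x - ract s x.
Proof. by rewrite ractDl ractNl. Qed.
Lemma ract_sum r n (F : 'I_n -> M) : ract r (\sum_i F i) = \sum_i ract r (F i).
Proof. exact: scaler_sumr. Qed.
Lemma ract_suml n (F : 'I_n -> R) x : ract (\sum_i F i) x = \sum_i ract (F i) x.
Proof. by rewrite /ract rmorph_sum; exact: scaler_suml. Qed.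

Lemma iter_thactD n x y : iter n thact (x + y) = iter n thact x + iter n thact y.
Proof. by elim: n => //= n ->; exact: scalerDr. Qed.
Lemma iter_thact0 n : iter n thact 0 = 0.
Proof. by elim: n => //= n ->; exact: scaler0. Qed.
Lemma iter_thactB n x y : iter n thact (x - y) = iter n thact x - iter n thact y.
Proof. by elim: n => //= n ->; exact: scalerBr. Qed.
Lemma iter_thact_sum n k (F : 'I_k -> M) :
  iter n thact (\sum_i F i) = \sum_i iter n thact (F i).
Proof.
by elim: n => //= n ->; exact: scaler_sumr.
Qed.

Definition is_rsubmod N :=
  [/\ N 0, (forall x y, N x -> N y -> N (x + y)) & (forall r x, N x -> N (ract r x))].

Lemma rsubmodB N x y : is_rsubmod N -> N x -> N y -> N (x - y).
Proof. by move=> [_ ND NZ] Nx Ny; apply: ND => //; rewrite -ractN1; exact: NZ. Qed.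

Lemma rsubmod_sum N n (F : 'I_n -> M) : is_rsubmod N -> (forall i, N (F i)) ->
  N (\sum_i F i).
Proof. by move=> [N0 ND _] h; apply: (@big_ind _ N). Qed.

Lemma submod_rsubmod N : is_submod N -> is_rsubmod N.
Proof. by move=> [? ? h]; split=> // r x; exact: h. Qed.

Lemma cyclic_submod x : is_submod (fun y => exists s : S^c, y = s *: x).
Proof.
split; first by exists 0; rewrite scale0r.
  by move=> _ _ [s ->] [t ->]; exists (s + t); rewrite scalerDl.
by move=> t _ [s ->]; exists (t * s); rewrite scalerA.
Qed.

Fixpoint rspan (X : seq M) (y : M) : Prop :=
  if X is x :: X' then exists r z, rspan X' z /\ y = ract r x + z else y = 0.

Lemma rspan_rsubmod X : is_rsubmod (rspan X).
Proof.
elim: X => [|x X [h0 hD hZ]].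
  by split=> //= [x y -> ->|r x ->]; [exact: addr0 | exact: ract0r].
split=> /=.
- by exists 0, 0; split=> //; rewrite ract0l addr0.
- move=> _ _ [r [z [hz ->]]] [s [w [hw ->]]]; exists (r + s), (z + w).
  by split; [exact: hD | rewrite ractDl addrACA].
- move=> s _ [r [z [hz ->]]]; exists (s * r), (ract s z).
  by split; [exact: hZ | rewrite ractDr ractA].
Qed.

Lemma rspan_catl X Y y : rspan X y -> rspan (X ++ Y) y.
Proof.
elim: X y => [|x X IH] y /=; first by move=> ->; case: (rspan_rsubmod Y).
by move=> [r [z [hz ->]]]; exists r, z; split=> //; exact: IH.
Qed.

Lemma rspan_catr X Y y : rspan Y y -> rspan (X ++ Y) y.
Proof.
by elim: X y => [//|x X IH] y /IH h /=; exists 0, y; rewrite ract0l add0r.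
Qed.

Lemma rspan_mem X x : x \in X -> rspan X x.
Proof.
elim: X => [//|z X IH]; rewrite inE => /orP [/eqP <-|/IH h] /=.
  by exists 1, 0; rewrite ract1 addr0; split=> //; case: (rspan_rsubmod X).
by exists 0, x; rewrite ract0l add0r.
Qed.

Lemma desc_le (T : Type) (D : nat -> T -> Prop) : (forall n, sub_pred (D n.+1) (D n)) ->
  forall m n, (m <= n)%N -> sub_pred (D n) (D m).
Proof.
move=> h m n /subnKC <-; elim: (n - m)%N => [|k IH] x; first by rewrite addn0.
by rewrite addnS => /h /IH.
Qed.

(** Induction on generators: [D k] is controlled by its ideal of coefficients of [x] modulo
    [rspan X] and by its part inside [rspan X]. *)
Lemma rspan_dcc X (D : nat -> M -> Prop) :
  (forall I : nat -> R -> Prop, (forall n, is_ideal (I n)) ->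
    (forall n, sub_pred (I n.+1) (I n)) ->
    exists n, forall m, (n <= m)%N -> sub_pred (I n) (I m)) ->
  (forall n, is_rsubmod (D n)) -> (forall n, sub_pred (D n.+1) (D n)) ->
  sub_pred (D 0%N) (rspan X) ->
  exists n, forall m, (n <= m)%N -> sub_pred (D n) (D m).
Proof.
move=> dcc; elim: X D => [|x X IH] D hD Ddec DX.
  by exists 0%N => m _ y /DX /= ->; case: (hD m).
have hX := rspan_rsubmod X; have [X0 XD XZ] := hX.
have [||n1 h1] := dcc (fun k r => exists z, rspan X z /\ D k (ract r x + z)).
- move=> k; have [D0 DD DZ] := hD k; split.
  + by exists 0; rewrite ract0l addr0.
  + move=> r s [z [hz Dz]] [w [hw Dw]]; exists (z + w); split; first exact: XD.
    by rewrite ractDl addrACA; exact: DD.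
  + move=> r s [z [hz Dz]]; exists (ract r z); split; first exact: XZ.
    by rewrite -ractA -ractDr; exact: DZ.
- by move=> k r [z [hz Dz]]; exists z; split=> //; exact: Ddec.
have [|||n2 h2] := IH (fun k y => D k y /\ rspan X y).
- move=> k; have [D0 DD DZ] := hD k; split=> // [y z [? ?] [? ?]|r y [? ?]].
    by split; [exact: DD | exact: XD].
  by split; [exact: DZ | exact: XZ].
- by move=> k y [/Ddec].
- by move=> y [].
exists (maxn n1 n2) => m; rewrite geq_max => /andP [n1m n2m] y Dy.
have Dle := desc_le Ddec.
have [r [z [hz ey]]] := DX y (Dle _ _ (leq0n _) _ Dy).
have Dy1 : D n1 y by apply: Dle Dy; exact: leq_maxl.
have Dy2 : D n2 y by apply: Dle Dy; exact: leq_maxr.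
have [|z' [hz' Dz']] := h1 m n1m r; first by exists z; rewrite -ey.
have [|Dm _] := h2 m n2m (y - (ract r x + z')).
  split; first by apply: rsubmodB => //; exact: Dle Dz'.
  by rewrite ey opprD addrACA subrr add0r; exact: rsubmodB.
by rewrite -[y](subrK (ract r x + z')); case: (hD m) => _ DD _; exact: DD.
Qed.

End RightAction.

(** * Commutation with [th] and submodules *)

Section SkewModule.
Variables (R : comNzRingType) (alpha : {rmorphism R -> R}) (beta : R -> R).
Variables (S : nzRingType) (iota : {rmorphism R -> S}) (th : S).
Hypothesis skew : is_skew_poly_ring alpha iota th.
Hypotheses (alphaK : cancel alpha beta) (betaK : cancel beta alpha).

Local Notation psi p := (\sum_(i < size p) iota p`_i * th ^+ i).

Lemma skew_eval n (p : {poly R}) : (size p <= n)%N ->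
  psi p = \sum_(i < n) iota p`_i * th ^+ i.
Proof.
move=> le; rewrite (big_ord_widen _ (fun i => iota p`_i * th ^+ i) le).
rewrite big_mkcond /=; apply: eq_bigr => i _.
by case: ltnP => // h; rewrite nth_default // rmorph0 mul0r.
Qed.

Lemma skew_iota_inj : injective iota.
Proof.
have [_ /bij_inj inj] := skew; move=> x y e; apply: polyC_inj; apply: inj => /=.
by rewrite !(@skew_eval 1) ?size_polyC_leq1 // !big_ord1 !coefC /= e.
Qed.

Lemma skew_theta_neq0 : th <> 0.
Proof.
have [_ /bij_inj inj] := skew; move=> e.
have /eqP : 'X = 0 :> {poly R}.
  apply: inj => /=; rewrite (@skew_eval 2) ?size_polyX // (@skew_eval 0) ?size_poly0 //.
  by rewrite big_ord0 big_ord_recl big_ord1 !coefX /= rmorph0 mul0r add0r expr1 e mulr0.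
by rewrite polyX_eq0.
Qed.

Lemma skew_iota_regular b : (forall r, b * r = 0 -> r = 0) ->
  forall s, iota b * s = 0 -> s = 0.
Proof.
have [_ bij] := skew; move=> reg s; have [g gK Kg] := bij.
rewrite -(Kg s) => e; have e0 : b *: g s = 0.
  apply: (bij_inj bij) => /=; rewrite (@skew_eval (size (g s))) ?size_scale_leq //.
  rewrite (@skew_eval 0) ?size_poly0 // big_ord0; apply: etrans e; rewrite mulr_sumr.
  by apply: eq_bigr => i _; rewrite coefZ rmorphM mulrA.
suff -> : g s = 0 by rewrite /= (@skew_eval 0) ?size_poly0 // big_ord0.
apply/polyP => i; rewrite coef0; apply: reg.
by rewrite -coefZ e0 coef0.
Qed.

Variable M : lmodType S^c.
Implicit Types (x y : M) (r : R) (N : M -> Prop).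
Local Notation ra := (ract iota).
Local Notation T := (@thact S th M).

Lemma ract_thact r x : ra r (T x) = T (ra (alpha r) x).
Proof.
rewrite /ract /thact !scalerA; congr (_ *: x).
by have [h _] := skew; exact: h.
Qed.

(** The relation [th^n r = alpha^n(r) th^n], read in a right module. *)
Lemma ract_iter n r x : ra r (iter n T x) = iter n T (ra (iter n alpha r) x).
Proof.
by elim: n r => //= n IH r; rewrite ract_thact IH -iterSr.
Qed.

Lemma iter_betaK n : cancel (iter n beta) (iter n alpha).
Proof. by move=> x; elim: n => //= n IH; rewrite -iterS iterSr betaK. Qed.

Lemma iter_alphaK n : cancel (iter n alpha) (iter n beta).
Proof. by move=> x; elim: n => //= n IH; rewrite -iterS iterSr alphaK. Qed.

Lemma iter_ract n r x : iter n T (ra r x) = ra (iter n beta r) (iter n T x).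
Proof. by rewrite ract_iter iter_betaK. Qed.

Lemma scale_pow n x : ((th ^+ n : S) : S^c) *: x = iter n T x.
Proof.
elim: n x => [|n IH] x; first exact: scale1r.
by rewrite iterSr -IH /thact scalerA exprS.
Qed.

Lemma scale_normal_form (s : S^c) :
  exists n (p : nat -> R), forall x, s *: x = \sum_(i < n) iter i T (ra (p i) x).
Proof.
have [_ [g _ Kg]] := skew; exists (size (g s)), (fun i => (g s)`_i) => x.
rewrite -{1}(Kg s) scaler_suml; apply: eq_bigr => i _.
by rewrite -scale_pow /ract scalerA.
Qed.

Lemma submod_criterion N : is_rsubmod iota N -> (forall x, N x -> N (T x)) -> is_submod N.
Proof.
move=> hN NT; have [N0 ND NZ] := hN; split=> // s x Nx.
have [n [p ->]] := scale_normal_form s.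
have NI k y : N y -> N (iter k T y) by elim: k => //= k IH /IH; exact: NT.
by apply: (rsubmod_sum hN) => i; apply: NI; exact: NZ.
Qed.

Lemma iter_image_submod l N : is_submod N ->
  is_submod (fun y => exists z, N z /\ y = iter l T z).
Proof.
move=> hN; have [N0 ND NZ] := hN; apply: submod_criterion.
  split; first by exists 0; rewrite iter_thact0.
    by move=> _ _ [z [Nz ->]] [w [Nw ->]]; exists (z + w); rewrite iter_thactD; split=> //; exact: ND.
  move=> r _ [z [Nz ->]]; exists (ra (iter l alpha r) z); rewrite ract_iter; split=> //; exact: NZ.
by move=> _ [z [Nz ->]]; exists (T z); rewrite -iterS iterSr; split=> //; exact: NZ.
Qed.

Lemma simple_generated x y : simple_mod M -> x <> 0 -> exists s : S^c, y = s *: x.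
Proof.
move=> [_ simp] x0; case: (simp _ (cyclic_submod x)) => h; last exact: h.
by case: x0; apply: h; exists 1; rewrite scale1r.
Qed.

(** The kernel of [T] is a submodule, [alpha] being surjective; were it all of [M], faithfulness
    would make [th] zero. *)
Lemma thact_injective : simple_mod M -> faithful_mod M -> forall x, T x = 0 -> x = 0.
Proof.
move=> [[x0 nx0] simp] faith; have [|//|all] := simp (fun x => T x = 0).
  apply: submod_criterion; last by move=> x ->; exact: scaler0.
  split; [exact: scaler0| |].
    by move=> x y ex ey; rewrite /thact scalerDr -/(T x) -/(T y) ex ey addr0.
  move=> r x ex; rewrite -[r](betaK) -ract_thact ex; exact: ract0r.
by case: skew_theta_neq0; apply: (faith th).
Qed.

Lemma iter_thact_injective n : simple_mod M -> faithful_mod M ->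
  forall x, iter n T x = 0 -> x = 0.
Proof. by move=> hs hf x; elim: n => //= n IH /(thact_injective hs hf) /IH. Qed.

(** The part of degree below [k] of the cyclic module [x S]. *)
Definition tspan x k y := exists p : nat -> R, y = \sum_(j < k) iter j T (ra (p j) x).

Lemma tspan_rsubmod x k : is_rsubmod iota (tspan x k).
Proof.
split.
- by exists (fun=> 0); rewrite big1 // => i _; rewrite ract0l iter_thact0.
- move=> _ _ [p ->] [q ->]; exists (fun j => p j + q j).
  by rewrite -big_split; apply: eq_bigr => i _ /=; rewrite ractDl iter_thactD.
- move=> r _ [p ->]; exists (fun j => iter j alpha r * p j).
  by rewrite ract_sum; apply: eq_bigr => i _; rewrite ract_iter ractA.
Qed.

Lemma tspan_term x k i r : (i < k)%N -> tspan x k (iter i T (ra r x)).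
Proof.
move=> ik; exists (fun j => if j == i then r else 0).
rewrite (bigD1 (Ordinal ik)) //= eqxx big1 ?addr0 // => j ne.
by rewrite ifN ?ract0l ?iter_thact0.
Qed.

Lemma tspan_le x k l : (k <= l)%N -> sub_pred (tspan x k) (tspan x l).
Proof.
move=> kl _ [p ->]; apply: (rsubmod_sum (tspan_rsubmod x l)) => i.
by apply: tspan_term; apply: leq_trans kl.
Qed.

Lemma tspan_thact x k y : tspan x k y -> tspan x k.+1 (T y).
Proof.
move=> [p ->]; rewrite -[T _]/(iter 1 T _) iter_thact_sum.
apply: (rsubmod_sum (tspan_rsubmod x k.+1)) => i; rewrite -iterD add1n.
by apply: tspan_term; rewrite ltnS.
Qed.

End SkewModule.

(** * Krull dimension zero *)

Section DimensionZero.
Variables (R : comNzRingType) (alpha : {rmorphism R -> R}) (beta : R -> R).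
Variables (S : nzRingType) (iota : {rmorphism R -> S}) (th : S).
Hypothesis skew : is_skew_poly_ring alpha iota th.
Hypotheses (alphaK : cancel alpha beta) (betaK : cancel beta alpha).
Hypothesis hR : noetherian_ring R.

(** Otherwise some [r <> 0] is nilpotent and killed by all nilpotents. The [alpha^i(r)] are
    nilpotent, so [r S r = 0]. But [v r <> 0] for some [v], and [v] is in [v r S], whence
    [v r = 0]. *)
Lemma primitive_reduced : primitive_ring S -> forall y : R, y * y = 0 -> y = 0.
Proof.
move=> [M [simp faith]] y yy; apply: contrapT => y0.
have [|r [r0 [k rk] rnil]] := nilpotent_annihilator hR; first by exists y.
have [v rv] : exists v : M, ract iota r v <> 0.
  apply: contrapT => nv; apply: r0; apply: (skew_iota_inj skew).
  rewrite rmorph0; apply: (faith (iota r)) => m.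
  by apply: contrapT => h; apply: nv; exists m.
have [s es] := simple_generated v simp rv.
have [n [p hp]] := scale_normal_form skew M s.
apply: rv; rewrite es hp ract_sum big1 // => i _.
rewrite (ract_iter skew) !ractA -mulrA mulrC -mulrA [r * _]mulrC.
rewrite rnil ?mulr0 ?ract0l ?iter_thact0 //.
exists k; elim: (nat_of_ord i) => //= j IH; by rewrite -rmorphXn IH rmorph0.
Qed.

Hypothesis reg : forall r : R, exists s, r = r * r * s.

(** [I k] collects the coefficients that reduce to lower degree in degree [k]. If its limit,
    generated by [f], is proper, then from degree [k0] on nothing nonzero reduces on the complement
    [g = 1 - f], and this contradicts essentiality. *)
Lemma essential_tspan (V E : lmodType S^c) (j : {linear V -> E}) (x : E) :
  simple_mod V -> injective j -> essential_ext j ->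
  exists k, forall s : S^c, tspan iota th x k (s *: x).
Proof.
move=> simp injj ess.
pose T := @thact S th E; pose ra := @ract R S iota E.
pose I k r := tspan iota th x k (iter k T (ra r x)).
have hspan k : is_rsubmod iota (tspan iota th x k) by exact: (tspan_rsubmod skew).
have iI k : is_ideal (I k).
  have [h0 hD hZ] := hspan k; split.
  - by rewrite /I /ra ract0l /T iter_thact0.
  - by move=> r s hr hs; rewrite /I /ra ractDl /T iter_thactD; exact: hD.
  - move=> r s hs; rewrite /I /ra -ractA /T (iter_ract skew betaK); exact: hZ.
have Iasc k r : I k r -> I k.+1 r by move=> h; rewrite /I iterS; exact: (tspan_thact skew).
have [k0 hk0] := hR iI Iasc.
have [f [Jf ff hf]] := regular_ideal_idempotent hR reg (iI k0).
case: (EM (I k0 1)) => [J1|nJ1].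
  exists k0 => s; have [n [p ->]] := scale_normal_form skew E s.
  have le l : (k0 <= l)%N -> sub_pred (tspan iota th x l) (tspan iota th x k0).
    move=> /subnKC <-; elim: (l - k0)%N => [|d IH]; first by rewrite addn0.
    move=> y; rewrite addnS => -[q ->]; apply: IH; rewrite big_ord_recr /=.
    have [_ hD _] := hspan (k0 + d)%N; apply: hD; first by exists q.
    suff: I (k0 + d)%N (q (k0 + d)%N) by [].
    have [_ _ hM] := iI (k0 + d)%N; rewrite -[q _]mulr1; apply: hM.
    by apply/(hk0 (k0 + d)%N); rewrite ?leq_addr.
  have : tspan iota th x (maxn k0 n) (\sum_(i < n) iter i T (ra (p i) x)).
    by apply: (tspan_le skew (leq_maxr k0 n)); exists p.
  by apply: le; exact: leq_maxl.
exfalso; pose g := 1 - f.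
have cg c : I k0 (c * g) -> c * g = 0.
  by move=> /hf ->; rewrite /g -mulrA mulrBl mul1r ff subrr mulr0.
have cg_ge l c : (k0 <= l)%N -> I l (c * g) -> c * g = 0.
  by move=> kl /(hk0 l kl); exact: cg.
have g0 : g <> 0.
  by move=> /eqP; rewrite subr_eq0 => /eqP e; apply: nJ1; rewrite e.
pose U l y := exists z, (exists s : S^c, z = s *: ra g x) /\ y = iter l T z.
have [[v0 nv0] simpV] := simp.
have jv0 : j v0 <> 0 by move=> e; apply: nv0; apply: injj; rewrite e linear0.
(* [U l] is [x g S th^l], nonzero for large [l]; essentiality and simplicity force it to contain the
   image of [V]. *)
have Uv0 l : (k0 <= l)%N -> U l (j v0).
  move=> kl; have hU : is_submod (U l) := iter_image_submod skew l (cyclic_submod (ra g x)).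
  have [|v [Uv jv]] := ess _ hU.
    exists (iter l T (ra g x)); split.
      by exists (ra g x); split=> //; exists 1; rewrite scale1r.
    move=> e; apply: g0; rewrite -[g]mul1r; apply: (cg_ge l) => //.
    by rewrite mul1r /I e; case: (hspan l).
  have [U0 UD UZ] := hU.
  have [||h] := simpV (fun v => U l (j v)); last exact: h.
    split=> [|a b|s a]; rewrite ?linear0 ?linearD ?linearZ //; [exact: UD | exact: UZ].
  by move=> /(_ v Uv) e; case: jv; rewrite e linear0.
have UE l y : U l y -> exists n (p : nat -> R),
    y = \sum_(i < n) iter (l + i) T (ra (p i * g) x).
  move=> [_ [[s ->] ->]]; have [n [p ->]] := scale_normal_form skew E s.
  exists n, p; rewrite /T iter_thact_sum; apply: eq_bigr => i _.
  by rewrite -iterD ractA.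
(* The vector [j v0] has degree below [k0 + n], yet it also lies in [U (k0 + n)], so is a sum of
   terms of degree at least [k0 + n]. *)
have [n [p ep]] := UE _ _ (Uv0 k0 (leqnn _)).
have w1 : tspan iota th x (k0 + n) (j v0).
  rewrite ep; apply: (rsubmod_sum (hspan _)) => i; apply: tspan_term.
  by rewrite ltn_add2l.
have [n' [q eq]] := UE _ _ (Uv0 (k0 + n)%N (leq_addr _ _)).
apply: jv0; move: w1; rewrite eq; elim: n' {eq} => [|n' IH]; first by rewrite big_ord0.
rewrite big_ord_recr /=; set top := iter _ _ _; set rest := \sum_(i < n') _ => h.
have hrest : tspan iota th x (k0 + n + n') rest.
  apply: (rsubmod_sum (hspan _)) => i; apply: tspan_term.
  by rewrite ltn_add2l.
(* The whole sum and [rest] have degree below that of [top], so the coefficient of [top] reduces and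
   vanishes by [cg_ge]. *)
have top0 : top = 0.
  have e0 : q n' * g = 0.
    apply: (cg_ge (k0 + n + n')%N); first by rewrite -addnA leq_addr.
    rewrite /I -[iter _ _ _]/top (_ : top = rest + top - rest); last by rewrite addrC addKr.
    apply: (rsubmodB (hspan _)) => //.
    by apply: (tspan_le skew _ h); exact: leq_addr.
  by rewrite /top e0 /ra ract0l /T iter_thact0.
by move: h; rewrite top0 addr0 => /IH.
Qed.

(** Each [x S] is spanned over [R] by finitely many [x th^i], so [N] lies in a finite [R]-span,
    where descending chains of [R]-submodules stop. *)
Lemma regular_diamond : diamond S.
Proof.
move=> V E j simp [injj _ ess] N [n [g hN]].
have span1 (x : E) : exists X, forall s : S^c, rspan iota X (s *: x).
  have [k hk] := essential_tspan x simp injj ess.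
  exists [seq iter i (@thact S th E) x | i <- seq.iota 0 k] => s.
  set X := map _ _; have hX := rspan_rsubmod iota X; have [_ _ XZ] := hX.
  have [p ->] := hk s; apply: (rsubmod_sum hX) => i.
  rewrite (iter_ract skew betaK); apply: XZ.
  apply: rspan_mem; apply/mapP; exists (nat_of_ord i) => //.
  by rewrite mem_iota /= add0n.
have spans (gs : seq E) : exists X, forall x, x \in gs -> forall s : S^c, rspan iota X (s *: x).
  elim: gs => [|x gs [X hX]]; first by exists [::].
  have [Y hY] := span1 x; exists (Y ++ X) => z; rewrite inE => /orP [/eqP ->|zg] s.
    exact: rspan_catl.
  by apply: rspan_catr; exact: hX.
have [X hX] := spans (codom g).
move=> D hD DN Ddec.
have [||||m hm] := @rspan_dcc R S iota E X D.
- exact: regular_dcc.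
- by move=> k; apply: submod_rsubmod.
- exact: Ddec.
- move=> x /DN /hN [c ->]; apply: (rsubmod_sum (rspan_rsubmod iota _)) => i.
  by apply: hX; exact: codom_f.
exists m => k mk x; split; last exact: hm.
exact: desc_le.
Qed.

End DimensionZero.

(** * Injective hulls *)

Lemma zorn_pred (T : Type) (P : (T -> Prop) -> Prop) (A0 : T -> Prop) :
  P A0 -> (exists x, A0 x) ->
  (forall F : (T -> Prop) -> Prop, (exists A, F A) -> (forall A, F A -> P A) ->
    (forall A B, F A -> F B -> sub_pred A B \/ sub_pred B A) ->
    P (fun x => exists A, F A /\ A x)) ->
  exists A, P A /\ forall B, P B -> sub_pred A B -> sub_pred B A.
Proof.
move=> PA0 [x0 A0x0] chain.
(* [Zorn_bigcup] also asks for the union of the empty chain, hence the empty set. *)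
pose P' (A : set T) := ~ (exists x, A x) \/ P A.
have [|A [P'A Amax]] := @Zorn_bigcup T P'.
  move=> F FP' Ftot.
  case: (EM (exists A, F A /\ P A)) => [[A [FA PA]]|nA]; last first.
    left=> -[x [A FA Ax]]; apply: nA; exists A; split=> //.
    by case: (FP' A FA) => // h; case: h; exists x.
  right; rewrite (_ : bigcup F id = fun x => exists A, (F A /\ P A) /\ A x); last first.
    apply/seteqP; split=> x; last by move=> [B [[FB _] Bx]]; exists B.
    move=> [B FB Bx]; exists B; split=> //; split=> //.
    by case: (FP' B FB) => // h; case: h; exists x.
  apply: chain; first by exists A.
    by move=> B [].
  by move=> B B' [FB _] [FB' _]; exact: Ftot.
have Amax' B : P B -> sub_pred A B -> sub_pred B A.
  move=> PB AB; apply: contrapT => nBA; apply: (Amax B); last by right.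
  by split.
exists A; split=> //; case: P'A => // nA.
by case: (nA); exists x0; apply: (Amax' A0) => // x Ax; case: nA; exists x.
Qed.

(** * Subgroups with operators and relative complements *)

Section OperatorSubgroups.
Variables (Z : zmodType) (O : Type) (act : O -> Z -> Z).
Implicit Types N C D L : Z -> Prop.

(** Arbitrary operators cover [F]-subspaces, [R]-submodules and [S]-submodules at once. *)
Definition op_subgroup N :=
  [/\ N 0, (forall x y, N x -> N y -> N (x + y)) & (forall o x, N x -> N (act o x))].

Lemma chain_op_subgroup (F : (Z -> Prop) -> Prop) : (exists A, F A) ->
  (forall A, F A -> op_subgroup A) ->
  (forall A B, F A -> F B -> sub_pred A B \/ sub_pred B A) ->
  op_subgroup (fun x => exists A, F A /\ A x).
Proof.
move=> [A0 FA0] hF tot; split.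
- by exists A0; split=> //; case: (hF _ FA0).
- move=> x y [A [FA Ax]] [B [FB By]].
  case: (tot A B FA FB) => h; [exists B | exists A]; split=> //.
    by case: (hF _ FB) => _ hD _; apply: hD => //; exact: h.
  by case: (hF _ FA) => _ hD _; apply: hD => //; exact: h.
- by move=> o x [A [FA Ax]]; exists A; split=> //; case: (hF _ FA) => _ _; apply.
Qed.

Lemma max_disjoint L : (forall o, act o 0 = 0) ->
  exists C, [/\ op_subgroup C, forall x, C x -> L x -> x = 0 &
    forall D, op_subgroup D -> sub_pred C D -> (forall x, D x -> L x -> x = 0) ->
      sub_pred D C].
Proof.
move=> act0.
have [||F exF hF tot|C [[hC CL] Cmax]] := @zorn_pred Z
  (fun C => op_subgroup C /\ forall x, C x -> L x -> x = 0) (fun x => x = 0).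
- split; last by move=> x ->.
  by split=> // [x y -> ->|o x ->]; rewrite ?addr0.
- by exists 0.
- split; first by apply: chain_op_subgroup => // A /hF [].
  by move=> x [A [/hF [_ h] Ax]]; exact: h.
by exists C; split=> // D hD CD DL; apply: Cmax.
Qed.

End OperatorSubgroups.

Section LinearOf.
Variables (K : pzRingType) (A B : lmodType K).
Definition linear_of (f : A -> B) of linear f := f.
Variables (f : A -> B) (hf : linear f).
HB.instance Definition _ := GRing.isLinear.Build K A B *:%R (linear_of hf) hf.
Lemma linear_extensional : exists g : {linear A -> B}, forall x, g x = f x.
Proof. by exists (linear_of hf). Qed.
End LinearOf.

Section SubmoduleType.
Variables (S : nzRingType) (M : lmodType S^c) (N : M -> Prop) (hN : is_submod N).

Definition submod_pred of is_submod N : {pred M} := fun x => `[< N x >].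

Lemma submod_pred_closed : submod_closed (submod_pred hN).
Proof.
have [N0 ND NZ] := hN; split; first exact/asboolP.
by move=> a x y /asboolP Nx /asboolP Ny; apply/asboolP; apply: ND => //; exact: NZ.
Qed.

HB.instance Definition _ := GRing.isSubmodClosed.Build S^c M (submod_pred hN)
  submod_pred_closed.

Definition submod_type := {x : M | submod_pred hN x}.
HB.instance Definition _ := SubChoice.on submod_type.
HB.instance Definition _ := [SubChoice_isSubLmodule of submod_type by <:].

Lemma submod_typeP (x : submod_type) : N (val x).
Proof. exact/asboolP/(valP x). Qed.

Lemma submod_type_ex x : N x -> exists z : submod_type, val z = x.
Proof.
move=> Nx; have h : submod_pred hN x by exact/asboolP.
by exists (exist _ x h).
Qed.
End SubmoduleType.

(** * Coinduced modules are injective *)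

Section Coinduced.
Variables (F : fieldType) (S : nzRingType) (kappa : {rmorphism F -> S}) (M : lmodType S^c).

(* The right F-linear maps S -> M, with (h s)(t) = h(s t). *)
Record coinduced := Coinduced {
  coind_fun :> S -> M;
  coind_add : forall s t, coind_fun (s + t) = coind_fun s + coind_fun t;
  coind_scale : forall l s, coind_fun (s * kappa l) = (kappa l : S^c) *: coind_fun s }.

Lemma coind_eq (h k : coinduced) : (forall t, h t = k t) -> h = k.
Proof.
case: h k => h hD hZ [k kD kZ] /= /funext e; subst k.
by congr Coinduced; exact: Prop_irrelevance.
Qed.

HB.instance Definition _ := gen_eqMixin coinduced.
HB.instance Definition _ := gen_choiceMixin coinduced.

Program Definition coind0 := @Coinduced (fun=> 0) _ _.
Next Obligation. by rewrite addr0. Qed.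
Next Obligation. by rewrite scaler0. Qed.
Program Definition coindN (h : coinduced) := @Coinduced (fun t => - h t) _ _.
Next Obligation. by rewrite coind_add opprD. Qed.
Next Obligation. by rewrite coind_scale scalerN. Qed.
Program Definition coindD (h k : coinduced) := @Coinduced (fun t => h t + k t) _ _.
Next Obligation. by rewrite !coind_add addrACA. Qed.
Next Obligation. by rewrite !coind_scale scalerDr. Qed.
Program Definition coindZ (s : S^c) (h : coinduced) := @Coinduced (fun t => h ((s : S) * t)) _ _.
Next Obligation. by rewrite mulrDr coind_add. Qed.
Next Obligation. by rewrite mulrA coind_scale. Qed.

Lemma coindDA : associative coindD.
Proof. by move=> x y z; apply: coind_eq => t /=; rewrite addrA. Qed.
Lemma coindDC : commutative coindD.
Proof. by move=> x y; apply: coind_eq => t /=; rewrite addrC. Qed.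
Lemma coind0D : left_id coind0 coindD.
Proof. by move=> x; apply: coind_eq => t /=; rewrite add0r. Qed.
Lemma coindND : left_inverse coind0 coindN coindD.
Proof. by move=> x; apply: coind_eq => t /=; rewrite addNr. Qed.
HB.instance Definition _ := GRing.isZmodule.Build coinduced coindDA coindDC coind0D coindND.

Lemma coindZA (a b : S^c) (h : coinduced) : coindZ a (coindZ b h) = coindZ (a * b) h.
Proof. by apply: coind_eq => t /=; rewrite mulrA. Qed.
Lemma coind1Z : left_id 1 coindZ.
Proof. by move=> h; apply: coind_eq => t /=; rewrite mul1r. Qed.
Lemma coindZDr : right_distributive coindZ +%R.
Proof. by move=> a h k; apply: coind_eq. Qed.
Lemma coindZDl (h : coinduced) : {morph coindZ^~ h : a b / a + b}.
Proof. by move=> a b; apply: coind_eq => t /=; rewrite mulrDl coind_add. Qed.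
HB.instance Definition _ := GRing.Zmodule_isLmodule.Build S^c coinduced
  coindZA coind1Z coindZDr coindZDl.

(** Over the field [F] the image of [i] has a complement [C], hence [i] has an [F]-linear retraction
    [rho]. With [f1] the value of [f] at [1], the extension sends [b] to the map
    [s |-> f1 (rho (b s))]. *)
Lemma coinduced_injective : injective_mod coinduced.
Proof.
move=> A B i f inji.
pose fl (l : F) (x : B) := (kappa l : S^c) *: x.
have [C [hC CL Cmax]] := @max_disjoint B F fl (fun x => exists a, x = i a) (fun l => scaler0 _ _).
have [C0 CD CZ] := hC.
have CB x y : C x -> C y -> C (x - y).
  move=> Cx Cy; apply: CD => //; have := CZ (- 1) y Cy.
  by rewrite /fl rmorphN1; rewrite (_ : _ *: y = - y) //; exact: scaleN1r.
have ex b : exists a, C (b - i a).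
  case: (EM (C b)) => [Cb|nCb]; first by exists 0; rewrite linear0 subr0.
  pose D x := exists c l, C c /\ x = c + fl l b.
  have [x [[c [l [Cc ex]]] [a ea] x0]] : exists x, [/\ D x, exists a, x = i a & x <> 0].
    apply: contrapT => nx; apply: nCb; apply: (Cmax D).
    - split.
      + by exists 0, 0; rewrite /fl rmorph0 scale0r addr0.
      + move=> _ _ [c [l [Cc ->]]] [d [k [Cd ->]]]; exists (c + d), (l + k).
        by rewrite /fl rmorphD scalerDl addrACA; split=> //; exact: CD.
      + move=> k _ [c [l [Cc ->]]]; exists (fl k c), (k * l); split; first exact: CZ.
        by rewrite /fl scalerDr scalerA mulrC rmorphM.
    - by move=> c Cc; exists c, 0; rewrite /fl rmorph0 scale0r addr0.
    - by move=> x Dx Lx; apply: contrapT => x0; apply: nx; exists x.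
    - by exists 0, 1; rewrite /fl rmorph1 add0r; split=> //; rewrite (_ : _ *: b = b) //; exact: scale1r.
  have l0 : l != 0.
    apply/eqP => l0; apply: x0; apply: CL; last by exists a.
    by rewrite ex l0 /fl rmorph0 scale0r addr0.
  exists ((kappa l^-1 : S^c) *: a); rewrite linearZ -ea ex.
  have -> : b - (kappa l^-1 : S^c) *: (c + fl l b) = fl (- l^-1) c; last exact: CZ.
  rewrite scalerDr /fl scalerA.
  have -> : ((kappa l^-1 : S^c) * (kappa l : S^c)) = 1.
    by have := rmorphM kappa l l^-1; rewrite mulfV // rmorph1 => e; exact: (esym e).
  by rewrite scale1r rmorphN scaleNr opprD addrCA subrr addr0.
have [rho hrho] := choice ex.
have uniq b a : C (b - i a) -> rho b = a.
  move=> h; apply: inji; apply/eqP; rewrite -subr_eq0; apply/eqP; apply: CL; last first.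
    by exists (rho b - a); rewrite linearB.
  have -> : i (rho b) - i a = (b - i a) - (b - i (rho b)).
    by rewrite opprB [RHS]addrC addrA subrK.
  exact: CB.
have rhoD x y : rho (x + y) = rho x + rho y.
  apply: uniq; rewrite linearD opprD addrACA; exact: CD.
have rhoF l x : rho (fl l x) = (kappa l : S^c) *: rho x.
  by apply: uniq; rewrite linearZ -scalerBr; exact: CZ.
have rhoi a : rho (i a) = a by apply: uniq; rewrite subrr.
pose f1 a := f a 1.
have f1D x y : f1 (x + y) = f1 x + f1 y by rewrite /f1 linearD.
have f1F l x : f1 ((kappa l : S^c) *: x) = (kappa l : S^c) *: f1 x.
  by rewrite /f1 linearZ /= mulr1 -[kappa l in LHS]mul1r coind_scale.
have gD b s t : f1 (rho (((s + t : S) : S^c) *: b)) =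
    f1 (rho ((s : S^c) *: b)) + f1 (rho ((t : S^c) *: b)).
  by rewrite -f1D -rhoD -scalerDl.
have gF b l s : f1 (rho (((s * kappa l : S) : S^c) *: b)) =
    (kappa l : S^c) *: f1 (rho ((s : S^c) *: b)).
  by rewrite -f1F -rhoF /fl scalerA.
pose g b := Coinduced (gD b) (gF b).
have [|G hG] := @linear_extensional S^c B coinduced g.
  move=> s x y; apply: coind_eq => t /=.
  by rewrite scalerDr scalerA rhoD f1D.
exists G => a; rewrite hG; apply: coind_eq => t /=.
by rewrite -linearZ rhoi /f1 linearZ /= mulr1.
Qed.

Lemma coinduced_embedding : exists eta : {linear M -> coinduced}, injective eta.
Proof.
have hD (m : M) (s t : S) : ((s + t : S) : S^c) *: m = (s : S^c) *: m + (t : S^c) *: m.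
  exact: scalerDl.
have hZ (m : M) l (s : S) : ((s * kappa l : S) : S^c) *: m = (kappa l : S^c) *: ((s : S^c) *: m).
  by rewrite scalerA.
have [|eta heta] := @linear_extensional S^c M coinduced (fun m => Coinduced (hD m) (hZ m)).
  move=> s x y; apply: coind_eq => t /=.
  by rewrite scalerDr scalerA.
exists eta => x y; rewrite !heta => /(congr1 (fun h : coinduced => h 1)) /=.
by rewrite !scale1r.
Qed.

End Coinduced.

(** * The hull inside an injective module *)

Section Hull.
Variables (S : nzRingType) (M H : lmodType S^c) (eta : {linear M -> H}).
Hypotheses (eta_inj : injective eta) (injH : injective_mod H).

(** A maximal essential extension [E] of [M] inside [H] is a retract of [H]: with [C] a relative
    complement, the projection of [E + C] onto [E] extends to [g] on [H], whose image is still
    essential over [M], so equals [E]. Retracts of injectives are injective. *)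
Lemma injective_hull_in : exists (E : lmodType S^c) (j : {linear M -> E}), injective_hull j.
Proof.
pose ess (N : H -> Prop) := forall D, is_submod D -> sub_pred D N ->
  (exists x, D x /\ x <> 0) -> exists v, D (eta v) /\ eta v <> 0.
pose good N := [/\ is_submod N, forall v, N (eta v) & ess N].
have [||Fam exF hF tot|E [[hE Eeta Eess] Emax]] := @zorn_pred H good (fun x => exists v, x = eta v).
- split; last by move=> D hD Dsub [x [Dx x0]]; have [v e] := Dsub x Dx; exists v; rewrite -e.
    split; first by exists 0; rewrite linear0.
      by move=> _ _ [v ->] [w ->]; exists (v + w); rewrite linearD.
    by move=> s _ [v ->]; exists (s *: v); rewrite linearZ.
  by move=> v; exists v.
- by exists 0, 0; rewrite linear0.
- split.
  + by apply: (@chain_op_subgroup H S^c *:%R) => // A /hF [].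
  + by move=> v; have [A FA] := exF; exists A; split=> //; case: (hF A FA).
  + move=> D [D0 DD DZ] Dsub [x [Dx x0]]; have [A [FA Ax]] := Dsub x Dx.
    have [[A0 AD AZ] _ Aess] := hF A FA.
    have [|||v [[Dv _] v0]] := Aess (fun y => D y /\ A y); last by exists v.
    * split=> // [y z [Dy Ay] [Dz Az]|s y [Dy Ay]].
        by split; [exact: DD | exact: AD].
      by split; [exact: DZ | exact: AZ].
    * by move=> y [].
    * by exists x.
have [E0 ED EZ] := hE.
have [C [hC CE Cmax]] := @max_disjoint H S^c *:%R E (fun s => scaler0 _ s).
have [C0 CD CZ] := hC.
have EC x y e c : E x -> C y -> E e -> C c -> x + y = e + c -> x = e.
  move=> Ex Cy Ee Cc eq; apply/eqP; rewrite -subr_eq0; apply/eqP; apply: CE.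
    have -> : x - e = c - y.
      by apply: (addIr y); rewrite subrK addrAC eq addrAC subrr add0r.
    by apply: CD => //; rewrite -scaleN1r; exact: CZ.
  by apply: ED => //; rewrite -scaleN1r; exact: EZ.
pose W x := exists e c, [/\ E e, C c & x = e + c].
have hW : is_submod W.
  split; first by exists 0, 0; rewrite addr0.
    move=> _ _ [e [c [Ee Cc ->]]] [e' [c' [Ee' Cc' ->]]]; exists (e + e'), (c + c').
    by split; [exact: ED | exact: CD | rewrite addrACA].
  move=> s _ [e [c [Ee Cc ->]]]; exists (s *: e), (s *: c).
  by split; [exact: EZ | exact: CZ | rewrite scalerDr].
have ch (z : submod_type hW) : exists e, E e /\ exists c, C c /\ val z = e + c.
  by have [e [c [Ee Cc ez]]] := submod_typeP z; exists e; split=> //; exists c.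
have [p hp] := choice ch.
have pE (z : submod_type hW) e c : E e -> C c -> val z = e + c -> p z = e.
  move=> Ee Cc ez; have [Ep [c' [Cc' ez']]] := hp z.
  by apply: (EC _ c' _ c) => //; rewrite -ez'.
have [|P hP] := @linear_extensional S^c (submod_type hW) H p.
  move=> s x y; have [Ex [c [Cc ex]]] := hp x; have [Ey [d [Cd ey]]] := hp y.
  apply: (pE _ _ (s *: c + d)); first by apply: ED => //; exact: EZ.
    by apply: CD => //; exact: CZ.
  by rewrite linearP /= ex ey scalerDr addrACA.
have [g hg] := injH (i := (val : {linear submod_type hW -> H})) P val_inj.
have gEC e c : E e -> C c -> g (e + c) = e.
  move=> Ee Cc; have [|z ez] := @submod_type_ex _ _ _ hW (e + c); first by exists e, c.
  by rewrite -ez hg hP; apply: (pE _ _ c).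
have gE e : E e -> g e = e by move=> Ee; rewrite -[e in LHS]addr0 gEC.
have gC c : C c -> g c = 0 by move=> Cc; rewrite -[c]add0r gEC.
have gim x : E (g x).
  apply: (Emax (fun y => exists x, y = g x)); last by exists x.
    split.
    - split; first by exists 0; rewrite linear0.
        by move=> _ _ [v ->] [w ->]; exists (v + w); rewrite linearD.
      by move=> s _ [v ->]; exists (s *: v); rewrite linearZ.
    - by move=> v; exists (eta v); rewrite gE.
    - move=> D hD Dsub [y [Dy y0]]; have [x' ex'] := Dsub y Dy.
      have [D0 DD DZ] := hD.
      (* Otherwise the preimage of [D] under [g] contains [C] and meets [E] only in [0], hence
         equals [C], which [g] kills. *)
      have [w [Dw Ew w0]] : exists w, [/\ D (g w), E w & w <> 0].
        apply: contrapT => nw; apply: y0; rewrite ex'; apply: (gC).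
        apply: (Cmax (fun w => D (g w))); last by rewrite -ex'.
        + split=> [|a b|s a]; rewrite ?linear0 ?linearD ?linearZ //; [exact: DD | exact: DZ].
        + by move=> c Cc; rewrite gC.
        + by move=> w Dw Ew; apply: contrapT => w0; apply: nw; exists w.
      have [|||v [[Dv _] v0]] := Eess (fun y => D y /\ E y); last by exists v.
      * split=> // [a b [Da Ea] [Db Eb]|s a [Da Ea]].
          by split; [exact: DD | exact: ED].
        by split; [exact: DZ | exact: EZ].
      * by move=> a [].
      * by exists w; rewrite -{1}(gE w Ew).
  by move=> e Ee; exists e; rewrite gE.
pose EM := submod_type hE.
have [j0 hj0] := choice (fun v => @submod_type_ex _ _ _ hE _ (Eeta v)).
have [|j hj] := @linear_extensional S^c M EM j0.
  by move=> s x y; apply: val_inj; rewrite linearP /= !hj0 linearP.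
have [r0 hr0] := choice (fun x => @submod_type_ex _ _ _ hE _ (gim x)).
exists EM, j; split.
- by move=> x y; rewrite !hj => /(congr1 val); rewrite !hj0; exact: eta_inj.
- move=> A B i f inji.
  have [|f' hf'] := @linear_extensional S^c A H (fun a => val (f a)).
    by move=> s x y; rewrite !linearP.
  have [h hh] := injH f' inji.
  have [|k hk] := @linear_extensional S^c B EM (fun b => r0 (h b)).
    by move=> s x y; apply: val_inj; rewrite linearP /= !hr0 !linearP.
  exists k => a; apply: val_inj; rewrite hk hr0 hh hf'; apply: gE; exact: submod_typeP.
- move=> N [N0 ND NZ] [x [Nx x0]].
  have [|||v [[z [Nz ez]] v0]] := Eess (fun y => exists z : EM, N z /\ val z = y).
  + split; first by exists 0; rewrite linear0.
      by move=> _ _ [a [Na <-]] [b [Nb <-]]; exists (a + b); rewrite linearD; split=> //; exact: ND.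
    by move=> s _ [a [Na <-]]; exists (s *: a); rewrite linearZ; split=> //; exact: NZ.
  + by move=> _ [z [_ <-]]; exact: submod_typeP.
  + exists (val x); split; first by exists x.
    by move=> e; apply: x0; apply: val_inj; rewrite linear0.
  exists v; rewrite hj; have <- : z = j0 v by apply: val_inj; rewrite hj0.
  by split=> // z0; apply: v0; rewrite -ez z0 linear0.
Qed.

End Hull.

Lemma injective_hull_exists (F : fieldType) (S : nzRingType) (kappa : {rmorphism F -> S})
  (M : lmodType S^c) : exists (E : lmodType S^c) (j : {linear M -> E}), injective_hull j.
Proof.
have [eta heta] := coinduced_embedding kappa M.
exact: injective_hull_in heta (@coinduced_injective F S kappa M).
Qed.

(** * Failure of the property in part (b) *)

Section RmorphismOf.
Variables (R : comNzRingType).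
Definition rmorphism_of (f : R -> R) of zmod_morphism f & monoid_morphism f := f.
Variables (f : R -> R) (fD : zmod_morphism f) (fM : monoid_morphism f).
HB.instance Definition _ := GRing.isZmodMorphism.Build R R (rmorphism_of fD fM) fD.
HB.instance Definition _ := GRing.isMonoidMorphism.Build R R (rmorphism_of fD fM) fM.
Lemma rmorphism_extensional : exists g : {rmorphism R -> R}, forall x, g x = f x.
Proof. by exists (rmorphism_of fD fM). Qed.
End RmorphismOf.

Lemma inverse_rmorphism (R : comNzRingType) (alpha : {rmorphism R -> R}) :
  bijective alpha -> exists beta : {rmorphism R -> R}, cancel alpha beta /\ cancel beta alpha.
Proof.
move=> [g gK Kg].
have [||beta hb] := @rmorphism_extensional R g.
- by move=> x y; apply: (can_inj gK); rewrite rmorphB !Kg.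
- split; first by apply: (can_inj gK); rewrite rmorph1 Kg.
  by move=> x y; apply: (can_inj gK); rewrite rmorphM !Kg.
by exists beta; split=> x; rewrite ?hb ?gK ?Kg.
Qed.

Lemma iter_rmorphism (R : comNzRingType) (f : {rmorphism R -> R}) n :
  exists g : {rmorphism R -> R}, iter n f = g.
Proof.
have [||g hg] := @rmorphism_extensional R (iter n f).
- by move=> x y; elim: n => //= n ->; rewrite rmorphB.
- split; first by elim: n => //= n ->; rewrite rmorph1.
  by move=> x y; elim: n => //= n ->; rewrite rmorphM.
by exists g; apply: funext => x; rewrite hg.
Qed.

Lemma preim_ideal (R : comNzRingType) (f : {rmorphism R -> R}) (A : R -> Prop) n :
  is_ideal A -> is_ideal (fun x => A (iter n f x)).
Proof.
have [g ->] := iter_rmorphism f n.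
by move=> [A0 AD AM]; split=> [|x y|r x]; rewrite ?rmorph0 ?rmorphD ?rmorphM //; auto.
Qed.

Lemma preim_prime (R : comNzRingType) (f : {rmorphism R -> R}) (A : R -> Prop) n :
  is_prime_ideal A -> is_prime_ideal (fun x => A (iter n f x)).
Proof.
move=> [hA A1 AM]; split; first exact: preim_ideal.
  by have [g ->] := iter_rmorphism f n; rewrite rmorph1.
by have [g ->] := iter_rmorphism f n; move=> a b; rewrite rmorphM; exact: AM.
Qed.

(** * The prime annihilator [P] of an element of a faithful simple module *)

Section NotDiamond.
Variables (R : comNzRingType) (alpha beta : {rmorphism R -> R}).
Variables (S : nzRingType) (iota : {rmorphism R -> S}) (th : S).
Hypothesis skew : is_skew_poly_ring alpha iota th.
Hypotheses (alphaK : cancel alpha beta) (betaK : cancel beta alpha).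
Hypothesis hR : noetherian_ring R.
Variables (F : fieldType) (phi : {rmorphism F -> R}).
Hypothesis uF : uncountable_type F.
Variable M : lmodType S^c.
Hypotheses (simpM : simple_mod M) (faithM : faithful_mod M).

Local Notation ra := (ract iota).
Local Notation T := (@thact S th M).
Local Notation aiter n := (iter n alpha).
Local Notation biter n := (iter n beta).
Let abK n : cancel (biter n) (aiter n) := iter_betaK betaK n.
Let baK n : cancel (aiter n) (biter n) := iter_alphaK alphaK n.

Lemma alpha_stable (A : R -> Prop) n : is_ideal A ->
  (forall x, A (aiter n x) -> A x) -> forall x, A x -> A (aiter n x).
Proof.
move=> hA h; apply: (automorphism_ideal_stable hR (baK n) (abK n)) => // x y;
by have [g ->] := iter_rmorphism beta n; rewrite ?rmorphD ?rmorphM.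
Qed.

Lemma beta_stable (A : R -> Prop) n : is_ideal A ->
  (forall x, A (biter n x) -> A x) -> forall x, A x -> A (biter n x).
Proof.
move=> hA h; apply: (automorphism_ideal_stable hR (abK n) (baK n)) => // x y;
by have [g ->] := iter_rmorphism alpha n; rewrite ?rmorphD ?rmorphM.
Qed.

Lemma faithful_iota r : (forall x : M, ra r x = 0) -> r = 0.
Proof.
move=> h; apply: (skew_iota_inj skew); rewrite rmorph0; exact: (faithM (s := iota r)).
Qed.

Lemma prime_annihilator :
  exists m : M, m <> 0 /\ is_prime_ideal (fun r => ra r m = 0).
Proof.
have [[x0 nx0] _] := simpM.
pose G I := exists m : M, m <> 0 /\ I = (fun r => ra r m = 0).
have iann (m : M) : is_ideal (fun r => ra r m = 0).
  split=> [|r s hr hs|r s hs]; first exact: ract0l.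
    by rewrite ractDl hr hs addr0.
  by rewrite -ractA hs ract0r.
have [|I [m [_ ->]]//|I [[m [m0 eI]] Imax]] := @noetherian_max R G hR.
  by exists (fun r => ra r x0 = 0), x0.
exists m; split=> //; split=> //; first by rewrite ract1.
move=> r s rs; case: (EM (ra s m = 0)) => [|sm]; [by right | left].
have : I r; last by rewrite eI.
apply: (Imax (fun t => ra t (ra s m) = 0)); last by rewrite ractA.
  by exists (ra s m).
by rewrite eI => t tm; rewrite ractA mulrC -ractA tm ract0r.
Qed.

Variable m : M.
Hypothesis m0 : m <> 0.
Let P (r : R) : Prop := ra r m = 0.
Hypothesis hP : is_prime_ideal P.
Let iP : is_ideal P := prime_is_ideal hP.

Lemma generated y : exists n (q : nat -> R), y = \sum_(i < n) ra (q i) (iter i T m).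
Proof.
have [s ->] := simple_generated y simpM m0.
have [n [p ->]] := scale_normal_form skew M s.
exists n, (fun i => biter i (p i)); apply: eq_bigr => i _.
by rewrite (iter_ract skew betaK).
Qed.

(** Write [m = m th s]. If no positive power of [alpha] preserved [P], there would be [t i] outside
    [P] with [alpha^(i+1)(t i)] in [P]; the product of enough of them kills every term of [m th s],
    hence [m], yet lies outside [P]. *)
Lemma annihilator_periodic :
  exists k, (0 < k)%N /\ forall x, P (aiter k x) <-> P x.
Proof.
apply: contrapT => nper.
have ext i : exists t, P (aiter i.+1 t) /\ ~ P t.
  apply: contrapT => nt; apply: nper; exists i.+1; split=> //.
  have h x : P (aiter i.+1 x) -> P x.
    by move=> Px; apply: contrapT => nPx; apply: nt; exists x.
  by move=> x; split; [exact: h | exact: alpha_stable].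
have [t ht] := choice ext.
have Tm0 : T m <> 0 by move=> /(thact_injective skew betaK simpM faithM).
have [s es] := simple_generated m simpM Tm0.
have [n [p hp]] := scale_normal_form skew M s.
have [//|] := @prime_prodN R P n t hP; first by move=> i _; case: (ht i).
rewrite /P [X in ra _ X]es hp ract_sum big1 // => i _.
rewrite (ract_thact skew) -[T _]/(iter 1 T _) -iterD addn1 (ract_iter skew) ractA.
rewrite (_ : ra _ m = 0) ?iter_thact0 //.
suff : P (aiter i.+1 (\prod_(j < n) t j)) by move=> h; rewrite mulrC -ractA h ract0r.
rewrite (bigD1 i) //=; have [g eg] := iter_rmorphism alpha i.+1.
have [h _] := ht i; move: h; rewrite -[alpha _]/(aiter i.+1 _) !eg rmorphM => h.
exact: ideal_mulr.
Qed.

(** Such an [x] kills every [m th^i], and these span [M] over [R]. *)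
Lemma orbit_zero x : (forall i, P (aiter i x)) -> x = 0.
Proof.
move=> h; apply: faithful_iota => y; have [n [q ->]] := generated y.
rewrite ract_sum big1 // => i _; rewrite ractA mulrC -ractA (ract_iter skew).
by rewrite (h i) iter_thact0 ract0r.
Qed.

(** By periodicity finitely many translates of [P] already intersect in [0], so a prime contains one
    of them. *)
Lemma orbit_below_prime (p : R -> Prop) : is_prime_ideal p ->
  exists i, forall x, P (aiter i x) -> p x.
Proof.
move=> hp; have [k [k0 per]] := annihilator_periodic.
apply: contrapT => ni.
have ext i : exists t, P (aiter i t) /\ ~ p t.
  apply: contrapT => nt; apply: ni; exists i => x Px.
  by apply: contrapT => npx; apply: nt; exists x.
have [t ht] := choice ext.
have [//|] := @prime_prodN R p k t hp; first by move=> i _; case: (ht i).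
rewrite (_ : \prod_(i < k) t i = 0); first by case: hp => -[].
apply: orbit_zero.
have small i : (i < k)%N -> P (aiter i (\prod_(j < k) t j)).
  move=> ik; rewrite (bigD1 (Ordinal ik)) //=; have [g eg] := iter_rmorphism alpha i.
  have [h _] := ht i; move: h; rewrite !eg rmorphM => h.
  exact: ideal_mulr.
move=> i; rewrite {1}(divn_eq i k); elim: (i %/ k)%N => [|d IH].
  by rewrite mul0n add0n; apply: small; rewrite ltn_mod.
by rewrite mulSn -addnA iterD; apply/per.
Qed.

(** [N] is an [R]-submodule maximal for meeting [m R] only in [0]. If [m th^i] is not in [N],
    maximality gives a nonzero element of [m R] in [N + m th^i R], and its coefficient is [s i],
    unless some element outside [P] already kills [m th^i]. *)
Lemma torsion_bound : exists N (s : nat -> R), [/\ is_rsubmod iota N,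
  forall r, N (ra r m) -> P r, forall i, ~ P (s i) &
  forall i, exists r z, N z /\ ra (s i) (iter i T m) = ra r m + z].
Proof.
have [N [hN NL Nmax]] := @max_disjoint M R (@ract R S iota M)
  (fun x => exists r, x = ra r m) (@ract0r R S iota M).
have [N0 ND NZ] := hN.
have ext i : exists s, ~ P s /\ exists r z, N z /\ ra s (iter i T m) = ra r m + z.
  set x := iter i T m.
  case: (EM (exists t, P (aiter i t) /\ ~ P t)) => [[t [Pt nPt]]|nt].
    exists t; split=> //; exists 0, 0; split=> //.
    by rewrite ract0l addr0 /x (ract_iter skew) Pt iter_thact0.
  have stab := @alpha_stable P i iP; have {stab} stab : forall t, P t -> P (aiter i t).
    by apply: stab => t Pt; apply: contrapT => nPt; apply: nt; exists t.
  case: (EM (N x)) => [Nx|nNx].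
    exists 1; split; first by case: hP.
    by exists 0, x; rewrite ract0l add0r ract1.
  pose D y := exists z r, N z /\ y = z + ra r x.
  have [y [[z [r [Nz ey]]] [r' er'] y0]] :
      exists y, [/\ D y, exists r, y = ra r m & y <> 0].
    apply: contrapT => ny; apply: nNx; apply: (Nmax D).
    - split.
      + by exists 0, 0; rewrite ract0l addr0.
      + move=> _ _ [z [r [Nz ->]]] [w [s [Nw ->]]]; exists (z + w), (r + s).
        by rewrite ractDl addrACA; split=> //; exact: ND.
      + move=> s _ [z [r [Nz ->]]]; exists (ra s z), (s * r).
        by rewrite ractDr ractA; split=> //; exact: NZ.
    - by move=> z Nz; exists z, 0; rewrite ract0l addr0.
    - by move=> y Dy Ly; apply: contrapT => y0; apply: ny; exists y.
    - by exists 0, 1; rewrite ract1 add0r.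
  exists r; split.
    move=> Pr; apply: y0; apply: NL; last by exists r'.
    by rewrite ey /x (ract_iter skew) (stab r Pr) iter_thact0 addr0.
  exists r', (- z); split; first by rewrite -(ractN1 iota); exact: NZ.
  by rewrite -er' ey addrC addKr.
have [s hs] := choice ext.
exists N, s; split=> //; [by move=> r h; apply: NL => //; exists r | by move=> i; case: (hs i)|].
by move=> i; case: (hs i).
Qed.

(** This is [M Q], expressed through the [R]-generators [m th^i] of [M]. *)
Definition mspan (Q : R -> Prop) y := exists n (q : nat -> R),
  (forall i, Q (q i)) /\ y = \sum_(i < n) ra (q i) (iter i T m).

Lemma mspan_rsubmod (Q : R -> Prop) : is_ideal Q -> is_rsubmod iota (mspan Q).
Proof.
move=> [Q0 QD QM].
have widen n n' (q : nat -> R) : (n <= n')%N -> (forall i, Q (q i)) ->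
    exists q' : nat -> R, (forall i, Q (q' i)) /\
    \sum_(i < n) ra (q i) (iter i T m) = \sum_(i < n') ra (q' i) (iter i T m).
  move=> nn' hq; exists (fun i => if (i < n)%N then q i else 0); split.
    by move=> i; case: ifP.
  rewrite (big_ord_widen _ (fun i => ra (q i) (iter i T m)) nn') big_mkcond /=.
  by apply: eq_bigr => i _; case: ifP; rewrite ?ract0l.
split.
- by exists 0%N, (fun=> 0); rewrite big_ord0.
- move=> _ _ [n [q [hq ->]]] [n' [q' [hq' ->]]]; exists (maxn n n').
  have [p [hp ->]] := widen _ _ q (leq_maxl n n') hq.
  have [p' [hp' ->]] := widen _ _ q' (leq_maxr n n') hq'.
  exists (fun i => p i + p' i); split; first by move=> i; exact: QD.
  by rewrite -big_split; apply: eq_bigr => i _ /=; rewrite ractDl.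
- move=> r _ [n [q [hq ->]]]; exists n, (fun i => r * q i); split.
    by move=> i; exact: QM.
  by rewrite ract_sum; apply: eq_bigr => i _; rewrite ractA.
Qed.

Lemma mspan_submod (Q : R -> Prop) : is_ideal Q -> (forall x, Q x -> Q (beta x)) ->
  is_submod (mspan Q).
Proof.
move=> hQ Qb; apply: (submod_criterion skew); first exact: mspan_rsubmod.
have [Q0 QD QM] := hQ.
move=> _ [n [q [hq ->]]]; exists n.+1, (fun i => if i is i'.+1 then beta (q i') else 0).
split; first by case=> // i; exact: Qb.
rewrite big_ord_recl ract0l add0r -[T _]/(iter 1 T _) iter_thact_sum.
by apply: eq_bigr => i _; rewrite (iter_ract skew betaK).
Qed.

(** * A prime [Q] strictly above [P] with [m] outside the localised [M Q] *)

Section Prime.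
Variable Q : R -> Prop.
Hypotheses (hQ : is_prime_ideal Q) (PQ : sub_pred P Q) (nQP : ~ sub_pred Q P).
Hypothesis mQ : forall c, ~ Q c -> ~ mspan Q (ra c m).
Let iQ : is_ideal Q := prime_is_ideal hQ.

(** Otherwise [P] lies inside its preimage under [alpha^l], so equals it by [beta_stable], and then
    [Q] lies inside [P]. *)
Lemma prime_not_in_orbit l : ~ (forall x, Q x -> P (aiter l x)).
Proof.
move=> h; apply: nQP => x Qx.
rewrite -[x](baK l); apply: (beta_stable (A := P)) => //; last exact: h.
by move=> y Py; rewrite -[y](abK l); apply: h; exact: PQ.
Qed.

(** Otherwise the intersection [I] of the translates of [Q] is stable under [beta] and contains a
    nonzero product of translates of [q]. Then [M I] is a nonzero submodule, hence [M], and [m] is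
    in [M Q], against [mQ]. *)
Lemma prime_not_periodic i : (0 < i)%N -> ~ (forall x, Q x -> Q (biter i x)).
Proof.
move=> i0 per.
have [q [Qq hq]] := countable_avoidance phi hR uF iQ (fun l => preim_ideal alpha l iP).
have nPq l : ~ P (aiter l q) by move=> /hq; exact: prime_not_in_orbit.
pose I x := forall l, Q (biter l x).
have iI : is_ideal I.
  split=> [l|x y hx hy l|r x hx l]; have [Q0 QD QM] := preim_ideal beta l iQ.
  - exact: Q0.
  - exact: QD (hx l) (hy l).
  - exact: QM (hx l).
pose x := \prod_(l < i) aiter l q.
have x0 : x <> 0.
  move=> x0; apply: (@prime_prodN R P i (fun l => aiter l q) hP) => [l _//|].
  by rewrite -/x x0; case: iP.
have Ix : I x.
  have small l : (l < i)%N -> Q (biter l x).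
    move=> li; rewrite /x (bigD1 (Ordinal li)) //=.
    have := baK l; have [g ->] := iter_rmorphism beta l => gK.
    by rewrite rmorphM gK; exact: ideal_mulr.
  move=> l; rewrite (divn_eq l i); elim: (l %/ i)%N => [|d IH].
    by rewrite mul0n add0n; apply: small; rewrite ltn_mod.
  by rewrite mulSn -addnA iterD; exact: per.
have Ib y : I y -> I (beta y) by move=> Iy l; have := Iy l.+1; rewrite iterSr.
have [y xy] : exists y : M, ra x y <> 0.
  apply: contrapT => ny; apply: x0; apply: faithful_iota => y.
  by apply: contrapT => h; apply: ny; exists y.
have [_ /(_ _ (mspan_submod iI Ib)) [z|all]] := simpM.
  apply: xy; apply: z; have [n [q' ->]] := generated y.
  exists n, (fun i => x * q' i); split; first by move=> j; exact: (@ideal_mulr R I x (q' j) iI Ix).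
  by rewrite ract_sum; apply: eq_bigr => j _; rewrite ractA.
apply: (mQ (c := 1)); first by case: hQ.
by have [n [q' [hq' ->]]] := all (ra 1 m); exists n, q'; split=> // j; exact: (hq' j 0%N).
Qed.

Lemma avoiding_element : exists b, [/\ Q b, forall i, ~ Q (biter i.+1 b) &
  forall r, b * r = 0 -> r = 0].
Proof.
(* Odd indices list the translates of [P], even ones those of [Q] from [beta^1] on, so that [Q]
   itself is left out. Being outside the former makes [b] regular, by [orbit_zero]. *)
pose J n := if odd n then (fun x => P (aiter n./2 x)) else (fun x => Q (biter n./2.+1 x)).
have hJ n : is_ideal (J n) by rewrite /J; case: ifP => _; exact: preim_ideal.
have [b [Qb hb]] := countable_avoidance phi hR uF iQ hJ.
exists b; split=> // [i Qi|r br].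
  have := hb i.*2; rewrite /J odd_double doubleK => /(_ Qi).
  exact: prime_not_periodic.
apply: orbit_zero => i.
have := preim_prime alpha i hP; move=> [_ _ /(_ b r)]; rewrite br; case=> //.
  by have [g ->] := iter_rmorphism alpha i; rewrite rmorph0; case: iP.
move=> Pb; have := hb i.*2.+1; rewrite /J /= odd_double /= uphalf_double => /(_ Pb) h.
by case: (prime_not_in_orbit h).
Qed.

Lemma hull_not_artinian (E : lmodType S^c) (j : {linear M -> E}) :
  injective j -> injective_mod E -> exists N : E -> Prop, fg_submod N /\ ~ artinian_submod N.
Proof.
move=> injj injE; have [b [Qb nQb regb]] := avoiding_element.
pose TE := @thact S th E.
have jT n x : j (iter n T x) = iter n TE (j x).
  by elim: n => //= n <-; rewrite /thact linearZ.
have jra r x : j (ra r x) = ra r (j x) by rewrite /ract linearZ.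
(* Left multiplication by [b] on [S] is injective, so [b s |-> m s] is well defined on [b S] and
   extends to [S]; [e] is the image of [1]. *)
have [e be] : exists e : E, ra b e = j m.
  have [|i hi] := @linear_extensional S^c S^c^o S^c^o (fun s => s * (iota b : S^c)).
    by move=> s x y; rewrite mulrDl -!mulrA.
  have [|f hf] := @linear_extensional S^c S^c^o E (fun s => (s : S^c) *: j m).
    by move=> s x y; rewrite scalerDl scalerA.
  have [|g hg] := injE _ _ i f.
    move=> x y; rewrite !hi => /eqP; rewrite -subr_eq0 -mulrBl => /eqP h.
    by apply/eqP; rewrite -subr_eq0; apply/eqP; apply: (skew_iota_regular skew regb h).
  exists (g 1); rewrite /ract -linearZ; have := hg 1; rewrite hi hf mul1r scale1r.
  by move=> <-; congr (g _); exact: mulr1.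
exists (fun y => exists s : S^c, y = s *: e); split.
  exists 1%N, (fun=> e) => x; split=> [[s ->]|[c ->]].
    by exists (fun=> s); rewrite big_ord1.
  by exists (c ord0); rewrite big_ord1.
move=> art.
have [|||l /(_ l.+1 (leqnSn l) (iter l TE e)) [_ h]] :=
    art (fun l y => exists z, (exists s : S^c, z = s *: e) /\ y = iter l TE z).
- by move=> l; apply: (iter_image_submod skew); exact: cyclic_submod.
- by move=> x [z [h ->]].
- move=> l x [z [[s ->] ->]]; exists (TE (s *: e)); rewrite -iterSr; split=> //.
  by exists ((th : S^c) * s); rewrite /TE /thact scalerA.
have {h} [_ [[s ->] eqn]] : exists z, (exists s : S^c, z = s *: e) /\ iter l TE e = iter l.+1 TE z.
  by apply: h; exists e; split=> //; exists 1; rewrite scale1r.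
have [n [p hp]] := scale_normal_form skew E s.
rewrite hp in eqn.
(* [alpha^l(r)] is [b * r0], and each [alpha^(l+i+1)(r)] is divisible by [b] and by
   [alpha^(i+1)(b)]. The factor [b] turns [e] into [m]; the other becomes [b] once moved past
   [th^(i+1)]. *)
pose r := biter l b * \prod_(i < n) biter (l + i.+1) b.
pose r0 := \prod_(i < n) biter i.+1 b.
have er0 : aiter l r = b * r0.
  rewrite /r /r0; have := abK l; have [g eg] := iter_rmorphism alpha l; rewrite eg => gK.
  rewrite rmorphM gK rmorph_prod; congr (_ * _); apply: eq_bigr => i _.
  by rewrite iterD gK.
have er (i : 'I_n) : exists w, aiter (l + i.+1) r = aiter i.+1 b * (w * b).
  rewrite /r (bigD1 i) //; set w := \prod_(_ < n | _) _; exists (aiter (l + i.+1) w).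
  have := abK (l + i.+1)%N.
  have -> : aiter i.+1 b = aiter (l + i.+1) (biter l b) by rewrite addnC iterD abK.
  have [g ->] := iter_rmorphism alpha (l + i.+1) => gK.
  by rewrite !rmorphM gK [b * _]mulrC.
have [w hw] := choice er.
pose y := \sum_(i < n) iter i.+1 T (ra (w i * p i) m).
(* Multiply [e th^l = e s th^(l+1)] by [r] and cancel [th^l], which acts injectively on [M]. *)
have key : ra r0 m = ra b y.
  apply/eqP; rewrite -subr_eq0; apply/eqP.
  apply: (iter_thact_injective skew betaK (n := l) simpM faithM).
  apply: injj; rewrite linear0 iter_thactB linearB; apply/eqP; rewrite subr_eq0; apply/eqP.
  have : ra r (iter l TE e) = ra r (iter l.+1 TE (\sum_(i < n) iter i TE (ra (p i) e))).
    by rewrite eqn.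
  rewrite (ract_iter skew) er0 mulrC -ractA be -jra -jT => ->.
  rewrite /TE iter_thact_sum ract_sum /y ract_sum iter_thact_sum linear_sum.
  apply: eq_bigr => i _.
  rewrite -iterD (ract_iter skew) addSnnS hw ractA.
  have -> : aiter i.+1 b * (w i * b) * p i = aiter i.+1 b * (w i * p i) * b by ring.
  rewrite -ractA be -jra -jT iterD -ractA.
  by rewrite (ract_iter skew).
have nQr0 : ~ Q r0 by apply: (prime_prodN (F := fun i => biter i.+1 b)).
apply: (mQ nQr0); rewrite key; have [k [q ->]] := generated y.
exists k, (fun i => b * q i); split; first by move=> i; exact: ideal_mulr.
by rewrite ract_sum; apply: eq_bigr => i _; rewrite ractA.
Qed.

End Prime.

(** The product [pi] of the [s i] moves all [m th^i] with [i < n] into [m R + N]. If [m c] is in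
    [M Q], comparing the parts in [m R] puts [c * pi] in [Q], although [c] and all [s i] lie
    outside. *)
Lemma torsion_prime N (s : nat -> R) (Q : R -> Prop) :
  is_rsubmod iota N -> (forall r, N (ra r m) -> P r) ->
  (forall i, exists r z, N z /\ ra (s i) (iter i T m) = ra r m + z) ->
  is_prime_ideal Q -> sub_pred P Q -> (forall i, ~ Q (s i)) ->
  forall c, ~ Q c -> ~ mspan Q (ra c m).
Proof.
move=> hN NP hs hQ PQ nQs c nQc [n [q [hq ec]]].
have iQ := prime_is_ideal hQ; have [_ ND NZ] := hN.
pose pi := \prod_(i < n) s i.
have ext (i : 'I_n) : exists rz : R * M, N rz.2 /\ ra pi (iter i T m) = ra rz.1 m + rz.2.
  have [r [z [Nz e]]] := hs i; rewrite /pi (bigD1 i) //=.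
  set u := \prod_(_ < n | _) _; exists (u * r, ra u z) => /=; split; first exact: NZ.
  by rewrite [s i * u]mulrC -(ractA iota u (s i)) e ractDr ractA.
have [f hf] := choice ext.
have e1 : ra (c * pi) m = ra (\sum_(i < n) q i * (f i).1) m + \sum_(i < n) ra (q i) (f i).2.
  rewrite mulrC -ractA ec ract_sum ract_suml -big_split; apply: eq_bigr => i _ /=.
  by rewrite ractA [pi * _]mulrC -(ractA iota (q i) pi) (hf i).2 ractDr ractA.
have /PQ Qd : P (c * pi - \sum_(i < n) q i * (f i).1).
  apply: NP; rewrite ractBl e1 addrAC subrr add0r.
  by apply: (rsubmod_sum hN) => i; apply: NZ; case: (hf i).
have : Q (c * pi).
  rewrite -[c * pi](subrK (\sum_(i < n) q i * (f i).1)); have [Q0 QD _] := iQ; apply: (QD) => //.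
  by apply: (@big_ind _ Q) => // i _; exact: ideal_mulr.
by apply: primeN => //; exact: (prime_prodN (F := s)).
Qed.

(** Every prime contains a translate of [P], so a suitable translate of it contains [P]. This moves
    a chain of primes above [P]; likewise, an enumeration of the primes over [P] would, through its
    countably many translates, enumerate all primes. *)
Lemma prime_chain_above : krull_dim_ge R 2 \/ spec_uncountable R ->
  (exists P1 P2, [/\ is_prime_ideal P1, is_prime_ideal P2,
      sub_pred P P1 /\ ~ sub_pred P1 P & sub_pred P1 P2 /\ ~ sub_pred P2 P1]) \/
  (~ exists f : nat -> R -> Prop, forall Q, is_prime_ideal Q -> sub_pred P Q ->
      exists n, forall x, f n x <-> Q x).
Proof.
case=> [[p [hp pinc]]|unc]; [left | right].
  have [i hi] := orbit_below_prime (hp 0%N isT).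
  have [p01 [x [p1x np0x]]] := pinc 0%N isT.
  have [p12 [z [p2z np1z]]] := pinc 1%N isT.
  have Pp0 y : P y -> p 0%N (biter i y) by move=> Py; apply: hi; rewrite abK.
  exists (fun y => p 1%N (biter i y)), (fun y => p 2 (biter i y)); split.
  - exact/preim_prime/hp.
  - exact/preim_prime/hp.
  - split; first by move=> y /Pp0; exact: p01.
    by move=> h; apply: np0x; apply: hi; apply: h; rewrite baK.
  - split; first by move=> y; exact: p12.
    by move=> /(_ (aiter i z)); rewrite !baK => /(_ p2z).
move=> [f hf]; apply: unc.
exists (fun n => if unpickle n is Some (i, k) then (fun x => f k (aiter i x)) else fun=> True).
move=> p hp; have [i hi] := orbit_below_prime hp.
have [||k hk] := hf (fun y => p (biter i y)); first exact: preim_prime.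
  by move=> y Py; apply: hi; rewrite abK.
exists (pickle (i, k)); rewrite pickleK => x.
by rewrite hk baK.
Qed.

End NotDiamond.

Theorem theorem5p4 (R : comNzRingType) (alpha : {rmorphism R -> R})
    (S : nzRingType) (iota : {rmorphism R -> S}) (th : S) :
  noetherian_ring R -> bijective alpha -> is_skew_poly_ring alpha iota th ->
  primitive_ring S ->
  (krull_dim_eq R 0 -> diamond S) /\
  (contains_uncountable_field R ->
     (krull_dim_ge R 2 \/ spec_uncountable R) -> ~ diamond S).
Proof.
move=> hR bij skew prim.
have [beta [alphaK betaK]] := inverse_rmorphism bij.
split=> [[_ ndim]|[F [phi uF]] big dia].
  apply: (regular_diamond skew betaK hR).
  exact: dim0_von_neumann_regular hR ndim (primitive_reduced skew hR prim).
have [M [simpM faithM]] := prim.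
have [m [m0 hP]] := prime_annihilator iota hR simpM.
(* The [s i] are fixed by [m] and [N] alone, so that [Q] can be chosen afterwards to avoid them. *)
have [N [s [hN NP nPs hs]]] := torsion_bound skew alphaK betaK hR hP.
have [Q [hQ PQ nQP nQs]] := prime_above_avoiding phi hR uF hP nPs
  (prime_chain_above skew alphaK betaK hR simpM faithM m0 hP big).
have mQ := torsion_prime hN NP hs hQ PQ nQs.
have [E [j hull]] := injective_hull_exists (iota \o phi) M.
have [injj injE _] := hull.
have [X [fgX nartX]] := hull_not_artinian skew alphaK betaK hR phi uF simpM faithM
  m0 hP hQ PQ nQP mQ injj injE.
exact: nartX (dia M E j simpM hull X fgX).
Qed.
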